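(* Let $0<p<1$ and $m\in\mathbb N$ ($m\ge1$), let $\{X_n,\ n\ge1\}$ be the steps of the elephant random walk that remembers only the first $m$ steps, with $P(X_1=1)=p=1-P(X_1=-1)$, and let $S_n=\sum_{k=1}^n X_k$. For $0\le k\le m$ put $$q_k=P(S_m=m-2k),\qquad r_k=\frac{(m-k)p+k(1-p)}{m},\qquad p_k=\frac{(m-2k)(2p-1)}{m}.$$ Then, as $n\to\infty$, $\dfrac{S_n}{n}$ converges in distribution to $\displaystyle\sum_{k=0}^m q_k\,\delta_{p_k}$, and $\dfrac{S_n-n(2p-1)S_m/m}{\sqrt n}$ converges in distribution to $\displaystyle\sum_{k=0}^m q_k\,\mathcal N_{0,4r_k(1-r_k)}$.
   Context: Elephant random walk remembering only the first $m$ steps: for every $n\ge1$, choose an index $K$ uniformly on $\{1,\dots,\min(n,m)\}$ and set $X_{n+1}=X_K$ with probability $p$ and $X_{n+1}=-X_K$ with probability $1-p$. All index choices and sign choices are mutually independent and independent of $X_1$. $\delta_a$ denotes the distribution function with a jump of height one at $a$ (unit point mass at $a$); $\mathcal N_{0,\sigma^2}$ denotes the distribution function of the normal law with mean $0$ and variance $\sigma^2$; convex combinations of distribution functions denote the corresponding mixture distributions. *)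

(* Defs.v *)
From HB Require Import structures.
From mathcomp Require Import all_boot all_order all_algebra finmap.
From mathcomp Require Import all_classical all_reals all_analysis.

Set Implicit Arguments.
Unset Strict Implicit.
Unset Printing Implicit Defensive.
Import Order.TTheory GRing.Theory Num.Theory.
Import numFieldNormedType.Exports.
Local Open Scope classical_set_scope.
Local Open Scope ring_scope.

Definition mutually_independent (d : measure_display) (T : measurableType d)
    (R : realType) (P : probability T R) (I : choiceType)
    (F : I -> set (set T)) : Prop :=
  forall (J : {fset I}) (A : I -> set T), (forall i, i \in J -> F i (A i)) ->
    P (\bigcap_(i in [set` J]) A i) = (\prod_(i <- J) P (A i))%E.

Definition generated (d d' : measure_display) (T : measurableType d)
    (T' : measurableType d') (f : T -> T') : set (set T) :=
  preimage_set_system setT f measurable.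

(* F plays the role of the distribution function of the limit law. *)
Definition cvg_in_distribution (d : measure_display) (T : measurableType d)
    (R : realType) (P : probability T R) (U : nat -> {RV P >-> R})
    (F : R -> \bar R) : Prop :=
  forall x : R, {for x, continuous F} -> cdf (U n) x @[n --> \oo] --> F x.

Definition dirac_cdf (R : realType) (a x : R) : \bar R := dirac a `]-oo, x].

(* v is the variance, whereas normal_prob takes the standard deviation;
   normal_prob m 0 is not the point mass at m, so v is meant to be positive. *)
Definition normal_cdf (R : realType) (v x : R) : \bar R :=
  normal_prob 0 (Num.sqrt v) `]-oo, x].

(* Steps are numbered from 1: X 0, K 0 and B 0 are irrelevant. K n is the index
   chosen for step n + 1, and B n says whether the step X_(K n) is repeated
   (true) or reversed (false). *)
Record elephant_first_steps (d : measure_display) (T : measurableType d)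
    (R : realType) (P : probability T R) (p : R) (m : nat)
    (X : nat -> {RV P >-> R}) (K : nat -> {RV P >-> nat})
    (B : nat -> {RV P >-> bool}) : Prop := {
  efs_index : forall n k : nat, (1 <= n)%N -> (1 <= k <= minn n m)%N ->
    P (K n @^-1` [set k]) = ((minn n m)%:R^-1)%:E ;
  efs_repeat : forall n : nat, (1 <= n)%N -> P (B n @^-1` [set true]) = p%:E ;
  efs_reverse : forall n : nat, (1 <= n)%N ->
    P (B n @^-1` [set false]) = (1 - p)%:E ;
  efs_step : forall (n : nat) (t : T), (1 <= n)%N ->
    X n.+1 t = if B n t then X (K n t) t else - X (K n t) t ;
  efs_indep : mutually_independent P (fun i : unit + (nat + nat) =>
    match i with
    | inl _ => generated (X 1%N)
    | inr (inl n) => generated (K n.+1)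
    | inr (inr n) => generated (B n.+1)
    end) }.

Definition position (d : measure_display) (T : measurableType d)
    (R : realType) (P : probability T R) (X : nat -> {RV P >-> R}) (n : nat) :
  T -> R := fun t => \sum_(1 <= k < n.+1) X k t.

Lemma measurable_position (d : measure_display) (T : measurableType d)
    (R : realType) (P : probability T R) (X : nat -> {RV P >-> R}) (n : nat) :
  measurable_fun setT (position X n).
Proof. by apply: measurable_sum => k; exact: measurable_funPT. Qed.

HB.instance Definition _ (d : measure_display) (T : measurableType d)
    (R : realType) (P : probability T R) (X : nat -> {RV P >-> R}) (n : nat) :=
  isMeasurableFun.Build _ _ _ _ (position X n) (measurable_position X n).

Arguments cvg_in_distribution {d T R} P U F.

(* Main.v *)
(* After step [m] the memory is frozen: given that [k] of the first [m]
   steps are minuses, the later steps are i.i.d., each a plus with probability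
   [plus_prob k]. The laws of [S_n] are therefore mixtures over [k] of binomial
   laws, and both limits reduce to the de Moivre-Laplace theorem.

   That theorem is proved without Stirling's formula. The ratio of consecutive
   binomial weights [b j] is elementary, so comparing [ln (b j)] with a quadratic
   in [j] shows that the weights, divided by the weight of the mode, converge
   after rescaling to a Gaussian density and are dominated by an integrable
   Gaussian. Dominated convergence then applies to the histogram, and the missing
   normalization is recovered from the fact that the weights sum to 1.

   Testing the histogram against an event that is eventually sure or eventually
   impossible at almost every rescaled position also yields the law of large
   numbers. *)

Require Import Defs.
From HB Require Import structures.
From mathcomp Require Import all_boot all_order all_algebra.
From mathcomp Require Import all_classical all_reals all_analysis.
From mathcomp Require Import measurable_realfun finmap ring lra zify.
Import Order.TTheory GRing.Theory Num.Theory.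
Import numFieldNormedType.Exports.
Local Open Scope classical_set_scope.
Local Open Scope ring_scope.

Set Implicit Arguments.
Unset Strict Implicit.
Unset Printing Implicit Defensive.

(** * Ratios of consecutive binomial weights *)

Section binomial_ratio.
Context {R : realType}.
Implicit Types (r : R) (N j k : nat).

Lemma binomial_pmf_gt0 N r j : 0 < r < 1 -> (j <= N)%N ->
  0 < binomial_pmf N r j.
Proof.
move=> /andP[r0 r1] jN; rewrite /binomial_pmf pmulrn_rgt0 ?bin_gt0//.
by rewrite mulr_gt0// exprn_gt0// subr_gt0.
Qed.

Lemma binomial_pmf_succ N r j : (j < N)%N ->
  binomial_pmf N r j.+1 * (j.+1%:R * (1 - r)) =
  binomial_pmf N r j * ((N%:R - j%:R) * r).
Proof.
move=> jN; rewrite /binomial_pmf /unstable.onem.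
have -> : (N - j = (N - j.+1).+1)%N by lia.
have H : j.+1%:R * 'C(N, j.+1)%:R = (N%:R - j%:R) * 'C(N, j)%:R :> R.
  by rewrite -natrB ?(ltnW jN)// -!natrM mul_bin_left.
rewrite -!(mulr_natr (_ * _)) exprS (exprS (1 - r)).
transitivity (r ^+ j * r * ((1 - r) * (1 - r) ^+ (N - j.+1)) *
   (j.+1%:R * 'C(N, j.+1)%:R)); first ring.
by rewrite H; ring.
Qed.

(** The ratio of consecutive weights is [A / B] with [B - A = d]. The upper bound is
    [ln (1 + x) <= x] for [A / B = 1 - d / B], the lower one the same inequality for
    [B / A = 1 + d / A]. *)
Lemma ln_binomial_pmf_succ N r j (d := j.+1%:R - N.+1%:R * r) : 0 < r < 1 ->
  (j < N)%N ->
  - (d / ((N%:R - j%:R) * r)) <=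
    ln (binomial_pmf N r j.+1) - ln (binomial_pmf N r j) <=
  - (d / (j.+1%:R * (1 - r))).
Proof.
move=> r01 jN.
have b1 := binomial_pmf_gt0 r01 jN; have b0 := binomial_pmf_gt0 r01 (ltnW jN).
have := binomial_pmf_succ r jN.
case/andP: r01 => r0 r1.
set A := (N%:R - j%:R) * r; set B := j.+1%:R * (1 - r).
have A0 : 0 < A by rewrite mulr_gt0// subr_gt0 ltr_nat.
have B0 : 0 < B by rewrite mulr_gt0// subr_gt0.
have dE : d = B - A by rewrite /d /B /A -!natr1; ring.
move=> E.
have /(congr1 (@ln R)) : binomial_pmf N r j.+1 / binomial_pmf N r j = A / B.
  by apply/eqP; rewrite eqr_div ?lt0r_neq0//; apply/eqP; rewrite E mulrC.
rewrite ln_div ?posrE// => ->.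
apply/andP; split.
  have -> : A / B = (B / A)^-1 by rewrite invf_div.
  rewrite lnV ?posrE ?divr_gt0// lerN2.
  have -> : B / A = 1 + d / A by rewrite dE mulrBl divff ?gt_eqF//; ring.
  apply: le_ln1Dx; rewrite dE mulrBl divff ?gt_eqF//.
  by have := divr_gt0 B0 A0; lra.
have -> : A / B = 1 + - (d / B) by rewrite dE mulrBl divff ?gt_eqF//; ring.
apply: le_ln1Dx; rewrite dE mulrBl divff ?gt_eqF//.
by have := divr_gt0 A0 B0; lra.
Qed.

(* [j0] is the mode. On either side of it the log-ratio of consecutive weights
   is beaten by that of a Gaussian of variance [N.+1]. *)
Lemma binomial_pmf_le_mode N r j0 j : 0 < r < 1 -> (j0 <= N)%N -> (j <= N)%N ->
  j0%:R <= N.+1%:R * r <= j0.+1%:R ->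
  ln (binomial_pmf N r j) - ln (binomial_pmf N r j0) <=
  ((j0%:R + 2^-1 - N.+1%:R * r) ^+ 2 - (j%:R + 2^-1 - N.+1%:R * r) ^+ 2)
   / (2 * N.+1%:R).
Proof.
move=> r01 j0N jN /andP[m1 m2]; have /andP[r0 r1] := r01.
pose E k := ln (binomial_pmf N r k) +
  (k%:R + 2^-1 - N.+1%:R * r) ^+ 2 / (2 * N.+1%:R).
have M0 : 0 < N.+1%:R :> R by rewrite ltr0n.
suff : E j <= E j0 by rewrite mulrBl lerBlDr addrAC lerBrDr [leRHS]addrC.
have step k : E k.+1 - E k = ln (binomial_pmf N r k.+1) -
    ln (binomial_pmf N r k) + (k.+1%:R - N.+1%:R * r) / N.+1%:R.
  by rewrite /E -(natr1 k); field; rewrite gt_eqF.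
have up k : (j0 <= k < N)%N -> E k.+1 <= E k.
  move=> /andP[jk kN]; rewrite -subr_le0 step.
  have /andP[_ h] := ln_binomial_pmf_succ r01 kN.
  apply: (le_trans (lerD h (lexx _))).
  have kM : 0 <= k.+1%:R - N.+1%:R * r.
    by rewrite subr_ge0 (le_trans m2)// ler_nat.
  (* What remains is [k.+1%:R * (1 - r) <= N.+1%:R]. Bounding [1 - r] by 1 here, and [r] by 1 in
     [down], is what makes the variance [N.+1] instead of [N.+1%:R * (r * (1 - r))]. *)
  rewrite addrC subr_le0 ler_wpM2l// lef_pV2 ?posrE//; last first.
    by rewrite mulr_gt0 ?subr_gt0// ltr0n.
  apply: (@le_trans _ _ (k.+1%:R * 1)); first by rewrite ler_wpM2l//; lra.
  by rewrite mulr1 ler_nat; lia.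
have down k : (k < j0)%N -> E k <= E k.+1.
  move=> kj; rewrite -subr_ge0 step.
  have kN : (k < N)%N by exact: leq_trans kj j0N.
  have /andP[h _] := ln_binomial_pmf_succ r01 kN.
  apply: le_trans (lerD h (lexx _)).
  have kM : k.+1%:R - N.+1%:R * r <= 0.
    by rewrite subr_le0 (le_trans _ m1)// ler_nat.
  rewrite addrC subr_ge0 ler_wnM2l// lef_pV2 ?posrE//; last first.
    by rewrite mulr_gt0 ?subr_gt0// ltr_nat.
  apply: (@le_trans _ _ ((N%:R - k%:R) * 1)).
    by rewrite ler_wpM2l ?subr_ge0 ?ler_nat ?(ltnW kN)//; lra.
  by rewrite mulr1 lerBlDr -natrD ler_nat; lia.
have hup i : (j0 + i <= N)%N -> E (j0 + i)%N <= E j0.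
  elim: i => [_|i IH h]; first by rewrite addn0.
  by rewrite addnS; apply: le_trans (up _ _) (IH _); lia.
have hdown i : (i <= j0)%N -> E (j0 - i)%N <= E j0.
  elim: i => [_|i IH h]; first by rewrite subn0.
  apply: le_trans (IH (ltnW h)).
  have -> : (j0 - i = (j0 - i.+1).+1)%N by lia.
  by apply: down; lia.
have [jj|jj] := leqP j0 j; first by rewrite -(subnKC jj) hup// subnKC.
by rewrite -(subKn (ltnW jj)) hdown// leq_subr.
Qed.

(* The shift by [1/2] makes the increment of the quadratic term exactly
   [(j.+1%:R - N.+1%:R * r) / (N.+1%:R * (r * (1 - r)))], which the log-ratio of
   the weights matches to first order. *)
Lemma ln_binomial_pmf_local N r j (L : R) : 0 < r < 1 -> (j < N)%N ->
  `|j.+1%:R - N.+1%:R * r| <= L ->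
  2 * L <= N.+1%:R * (r * (1 - r)) ->
  `|(ln (binomial_pmf N r j.+1) +
      (j.+1%:R + 2^-1 - N.+1%:R * r) ^+ 2 / (2 * (N.+1%:R * (r * (1 - r))))) -
    (ln (binomial_pmf N r j) +
      (j%:R + 2^-1 - N.+1%:R * r) ^+ 2 / (2 * (N.+1%:R * (r * (1 - r)))))| <=
  2 * L ^+ 2 / (N.+1%:R * (r * (1 - r))) ^+ 2.
Proof.
move=> r01 jN dL LW; have /andP[r0 r1] := r01.
have M0 : 0 < N.+1%:R :> R by rewrite ltr0n.
have := ln_binomial_pmf_succ r01 jN.
have dBA : j.+1%:R - N.+1%:R * r = j.+1%:R * (1 - r) - (N%:R - j%:R) * r.
  by rewrite -!natr1; ring.
set b1 := ln _; set b0 := ln _.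
move: dBA LW dL.
set W := N.+1%:R * (r * (1 - r)); set B := j.+1%:R * (1 - r).
set A := (N%:R - j%:R) * r; set d := j.+1%:R - N.+1%:R * r.
move=> dBA LW dL /andP[h1 h2].
have W0 : 0 < W by rewrite mulr_gt0// mulr_gt0// subr_gt0.
have BW : B - W = (1 - r) * d by rewrite /B /W /d; ring.
have AW : A - W = - r * d by rewrite /A /W /d -!natr1; ring.
have L0 : 0 <= L by exact: le_trans (normr_ge0 _) dL.
have dL2 : d ^+ 2 <= L ^+ 2 by rewrite -real_normK ?num_real// lerXn2r ?nnegrE.
move: dL; rewrite ler_norml => /andP[dL1 dL3].
(* [A] and [B] differ from [W] by at most [L], and [2 * L <= W]. *)
have BW2 : W / 2 <= B by nra.
have AW2 : W / 2 <= A by nra.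
have B0 : 0 < B by lra.
have A0 : 0 < A by lra.
have -> : b1 + (j.+1%:R + 2^-1 - N.+1%:R * r) ^+ 2 / (2 * W) -
          (b0 + (j%:R + 2^-1 - N.+1%:R * r) ^+ 2 / (2 * W)) = b1 - b0 + d / W.
  by rewrite /d -(natr1 j); field; rewrite gt_eqF.
(* The errors [d / A - d / W] and [d / W - d / B] both have the form [s * d ^+ 2 / (W * X)], with
   [(s, X)] equal to [(r, A)] and [(1 - r, B)]. *)
have bound X s : 0 <= s <= 1 -> W / 2 <= X -> s * d ^+ 2 / (W * X) <=
    2 * L ^+ 2 / W ^+ 2.
  move=> /andP[s0 s1] WX.
  have X0 : 0 < X by lra.
  rewrite ler_pdivrMr; last exact: mulr_gt0.
  rewrite mulrAC ler_pdivlMr; last exact: exprn_gt0.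
  have sd : s * d ^+ 2 <= L ^+ 2 by apply: le_trans dL2; rewrite ler_piMl// sqr_ge0.
  apply: le_trans (ler_wpM2r (sqr_ge0 W) sd) _.
  have -> : 2 * L ^+ 2 * (W * X) = L ^+ 2 * (W * (2 * X)) by ring.
  by rewrite ler_wpM2l ?sqr_ge0// expr2 ler_wpM2l; lra.
rewrite ler_norml; apply/andP; split.
- rewrite lerNl; apply: le_trans (bound A r _ AW2); last lra.
  have -> : r * d ^+ 2 / (W * A) = d / A - d / W.
    transitivity (d * (W - A) / (W * A)); first by rewrite -opprB AW; ring.
    by field; rewrite !gt_eqF.
  by lra.
- apply: le_trans (bound B (1 - r) _ BW2); last lra.
  have -> : (1 - r) * d ^+ 2 / (W * B) = d / W - d / B.
    transitivity (d * (B - W) / (W * B)); first by rewrite BW; ring.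
    by field; rewrite !gt_eqF.
  by lra.
Qed.

End binomial_ratio.

(** * Local limit of the weights relative to a central one *)

Section local_limit.
Context {R : realType}.
Implicit Types (r x : R) (N : nat) (j k : nat -> nat).

Lemma telescope_norm_le (D : nat -> R) (c : R) (a b : nat) : (a <= b)%N ->
  (forall i, (a <= i < b)%N -> `|D i.+1 - D i| <= c) ->
  `|D b - D a| <= (b%:R - a%:R) * c.
Proof.
move=> ab; rewrite -(subnKC ab); elim: (b - a)%N => [|i IH] h.
  by rewrite addn0 !subrr normr0 mul0r.
rewrite addnS -natr1 (_ : _ * c = c + ((a + i)%:R - a%:R) * c); last ring.
rewrite (_ : D _ - D a = (D (a + i).+1 - D (a + i)%N) + (D (a + i)%N - D a)).
  apply: le_trans (ler_normD _ _) (lerD _ _); first by apply: h; lia.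
  by apply: IH => l /andP[al la]; apply: h; lia.
ring.
Qed.

(** At most [2 * L] unit steps separate [j] from [k], and each costs the error of
    [ln_binomial_pmf_local]. For [L] of the order of the square root of [N], the total is of the
    inverse order. *)
Lemma ln_binomial_pmf_between N r (j k : nat) (L : R)
    (D := fun i : nat => ln (binomial_pmf N r i) +
      (i%:R + 2^-1 - N.+1%:R * r) ^+ 2 / (2 * (N.+1%:R * (r * (1 - r))))) :
  0 < r < 1 -> (j <= N)%N -> (k <= N)%N ->
  `|j%:R - N.+1%:R * r| <= L -> `|k%:R - N.+1%:R * r| <= L ->
  2 * L <= N.+1%:R * (r * (1 - r)) ->
  `|D j - D k| <= 2 * L * (2 * L ^+ 2 / (N.+1%:R * (r * (1 - r))) ^+ 2).
Proof.
move=> r01; wlog kj : j k / (k <= j)%N => [hw jN kN jL kL LW|].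
  have [/hw|/ltnW/hw] := leqP k j; first exact.
  by rewrite (distrC (D k)); exact.
move=> jN kN jL kL LW.
set c := _ / _ ^+ 2.
have := @telescope_norm_le D c k j kj; set goal := _ <= _ => h.
have {}h : goal.
  apply: h => i /andP[ki ij].
  apply: ln_binomial_pmf_local => //; first exact: leq_trans jN.
  move: jL kL; rewrite !ler_norml !lerBlDr !lerBrDr => /andP[_ j2] /andP[k1 _].
  apply/andP; split; first by apply: (le_trans k1); rewrite ler_nat ltnW.
  by apply: le_trans j2; rewrite ler_nat.
apply: (le_trans h); rewrite ler_wpM2r//.
  by apply: divr_ge0; [apply: mulr_ge0 => //|]; exact: sqr_ge0.
move: jL kL; rewrite !ler_norml => /andP[_ j2] /andP[k1 _].
by move: j2 k1; clear; set y := _ * r; lra.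
Qed.

Lemma cvg_invr_sqrtS : (Num.sqrt N.+1%:R)^-1 @[N --> \oo] --> (0 : R).
Proof.
rewrite -(@sqrtr0 R); under eq_fun do rewrite -sqrtrV//.
by apply: continuous_cvg; [exact: sqrt_continuous|exact: cvg_harmonic].
Qed.

(** Near the mean, [ln] of the weight is quadratic up to an additive constant and a vanishing error;
    the constant, which contains the normalization, cancels in the ratio. *)
Lemma binomial_pmf_ratio_cvg r j k x : 0 < r < 1 ->
  2 * ((j N)%:R - N.+1%:R * r) / Num.sqrt N.+1%:R @[N --> \oo] --> x ->
  2 * ((k N)%:R - N.+1%:R * r) / Num.sqrt N.+1%:R @[N --> \oo] --> 0 ->
  binomial_pmf N r (j N) / binomial_pmf N r (k N) @[N --> \oo] -->
    expR (- (x ^+ 2 / (8 * (r * (1 - r))))).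
Proof.
move=> r01 jx k0; have /andP[r0 r1] := r01.
set w := r * (1 - r); have w0 : 0 < w by rewrite mulr_gt0// subr_gt0.
pose u (i : nat -> nat) N := 2 * ((i N)%:R - N.+1%:R * r) / Num.sqrt N.+1%:R.
(* In terms of [u], [(i N)%:R + 2^-1 - N.+1%:R * r] is half of [Num.sqrt N.+1%:R] times
   [u i N + (Num.sqrt N.+1%:R)^-1]; squaring and dividing by [2 * (N.+1%:R * w)] gives the factor
   8. *)
have ucvg i (y : R) : u i N @[N --> \oo] --> y ->
    (u i N + (Num.sqrt N.+1%:R)^-1) ^+ 2 / (8 * w) @[N --> \oo] -->
    y ^+ 2 / (8 * w).
  move=> h; apply: cvgMr_tmp.
  have {}h : u i N + (Num.sqrt N.+1%:R)^-1 @[N --> \oo] --> y.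
    by rewrite -[y]addr0; apply: cvgD => //; exact: cvg_invr_sqrtS.
  exact: (@continuous_cvg _ _ _ _ _ _ (fun z : R => z ^+ 2) y (@sqr_continuous R y) h).
pose D N (i : nat) := ln (binomial_pmf N r i) +
      (i%:R + 2^-1 - N.+1%:R * r) ^+ 2 / (2 * (N.+1%:R * w)).
pose L0 := `|x| + 1.
have L00 : 0 < L0 by rewrite ltr_wpDl.
have ubound i (y : R) : `|y| <= `|x| -> u i N @[N --> \oo] --> y ->
    \forall N \near \oo, `|u i N| <= L0.
  move=> yx h; have {}h : `|u i N| @[N --> \oo] --> `|y| by exact: cvg_norm.
  apply: (cvgr_le _ h).
  by rewrite /L0 (le_lt_trans yx)// ltrDl.
have Mbig : \forall N \near \oo, 2 * L0 / w <= Num.sqrt N.+1%:R.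
  have : \forall N \near \oo, (Num.sqrt N.+1%:R)^-1 <= (2 * L0 / w)^-1.
    by apply: (cvgr_le _ cvg_invr_sqrtS); rewrite invr_gt0 !mulr_gt0 ?invr_gt0.
  by apply: filterS => N; rewrite lef_pV2// posrE ?sqrtr_gt0// !mulr_gt0 ?invr_gt0.
have good i N : `|u i N| <= L0 -> 2 * L0 / w <= Num.sqrt N.+1%:R ->
   [/\ `|(i N)%:R - N.+1%:R * r| <= L0 * Num.sqrt N.+1%:R,
       2 * (L0 * Num.sqrt N.+1%:R) <= N.+1%:R * w & (i N <= N)%N].
  move=> uL ML.
  have s0 : 0 < Num.sqrt N.+1%:R :> R by rewrite sqrtr_gt0.
  have ss : N.+1%:R = Num.sqrt N.+1%:R * Num.sqrt N.+1%:R :> R.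
    by rewrite -expr2 sqr_sqrtr.
  have i1 : `|(i N)%:R - N.+1%:R * r| <= L0 * Num.sqrt N.+1%:R.
    move: uL; rewrite /u normrM normfV (ger0_norm (ltW s0)) ler_pdivrMr//.
    apply: le_trans; rewrite normrM ger0_norm//.
    by have := normr_ge0 ((i N)%:R - N.+1%:R * r); lra.
  have i2 : 2 * (L0 * Num.sqrt N.+1%:R) <= N.+1%:R * w.
    have -> : N.+1%:R * w = Num.sqrt N.+1%:R * w * Num.sqrt N.+1%:R.
      by rewrite {1}ss mulrAC.
    by rewrite mulrA ler_wpM2r ?(ltW s0)// -ler_pdivrMr.
  (* The weight is positive only for an index at most [N], and [lnK] requires positivity. The window
     stays in range since [L0 * Num.sqrt N.+1%:R] is less than [N.+1%:R * (1 - r)]. *)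
  split=> //; rewrite -ltnS -(ltr_nat R).
  move: i1; rewrite ler_norml => /andP[_ i1].
  have M0 : 0 < N.+1%:R :> R by rewrite ltr0n.
  have : L0 * Num.sqrt N.+1%:R < N.+1%:R * (1 - r).
    have : 0 < L0 * Num.sqrt N.+1%:R by rewrite mulr_gt0.
    have : N.+1%:R * w <= N.+1%:R * (1 - r).
      by rewrite ler_wpM2l// ?(ltW M0)// /w ler_piMl; lra.
    lra.
  by move: i1; rewrite mulrBr mulr1; lra.
have jL := ubound _ _ (lexx _) jx.
have kL : \forall N \near \oo, `|u k N| <= L0.
  by apply: ubound k0; rewrite normr0.
have DD : D N (j N) - D N (k N) @[N --> \oo] --> 0.
  apply/cvgr0Pnorm_le => e e0.
  (* The bound of [ln_binomial_pmf_between] for [L = L0 * Num.sqrt N.+1%:R], simplified. *)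
  have Hc : 4 * L0 ^+ 3 / w ^+ 2 * (Num.sqrt N.+1%:R)^-1 @[N --> \oo] --> (0 : R).
    rewrite -(mulr0 (4 * L0 ^+ 3 / w ^+ 2)).
    by apply: cvgMl_tmp; exact: cvg_invr_sqrtS.
  near=> N.
  have [||j1 j2 j3] := @good j N; [by near: N|by near: N|].
  have [||k1 k2 k3] := @good k N; [by near: N|by near: N|].
  apply: le_trans (ln_binomial_pmf_between r01 j3 k3 j1 k1 j2) _.
  rewrite [leLHS](_ : _ = 4 * L0 ^+ 3 / w ^+ 2 * (Num.sqrt N.+1%:R)^-1).
    by near: N; exact: (cvgr_le _ Hc _ e0).
  have s0 : Num.sqrt N.+1%:R != 0 :> R by rewrite gt_eqF// sqrtr_gt0.
  have ss : N.+1%:R = Num.sqrt N.+1%:R ^+ 2 :> R by rewrite sqr_sqrtr.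
  rewrite -/w ss sqrtr_sqr ger0_norm ?sqrtr_ge0//.
  by field; rewrite s0 gt_eqF.
pose F N := D N (j N) - D N (k N) -
    ((u j N + (Num.sqrt N.+1%:R)^-1) ^+ 2 / (8 * w) -
     (u k N + (Num.sqrt N.+1%:R)^-1) ^+ 2 / (8 * w)).
have Dlim : F N @[N --> \oo] --> - (x ^+ 2 / (8 * w)).
  rewrite -[X in _ --> X]add0r -[X in 0 - X]subr0.
  rewrite -[X in _ --> 0 - (_ - X)](mul0r (8 * w)^-1) -[X in X / _](expr0n R 2).
  by apply: cvgB => //; apply: cvgB; exact: ucvg.
have Elim : expR (F N) @[N --> \oo] --> expR (- (x ^+ 2 / (8 * w))).
  exact: (@continuous_cvg _ _ _ _ _ _ expR _ (@continuous_expR R _) Dlim).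
apply: cvg_trans Elim; apply: near_eq_cvg; near=> N.
have [||_ _ j3] := @good j N; [by near: N|by near: N|].
have [||_ _ k3] := @good k N; [by near: N|by near: N|].
have b1 := binomial_pmf_gt0 r01 j3; have b0 := binomial_pmf_gt0 r01 k3.
rewrite -[RHS]lnK ?posrE ?divr_gt0// ln_div ?posrE//; congr expR.
have s0 : Num.sqrt N.+1%:R != 0 :> R by rewrite gt_eqF// sqrtr_gt0.
have ss : N.+1%:R = Num.sqrt N.+1%:R ^+ 2 :> R by rewrite sqr_sqrtr.
have E (i : nat -> nat) :
    ((i N)%:R + 2^-1 - N.+1%:R * r) ^+ 2 / (2 * (N.+1%:R * w)) =
    (u i N + (Num.sqrt N.+1%:R)^-1) ^+ 2 / (8 * w).
  rewrite /u; set s := Num.sqrt _ in s0 ss *; rewrite ss.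
  by field; rewrite s0 gt_eqF.
by rewrite /F /D !E; ring.
Unshelve. all: by end_near.
Qed.

End local_limit.

(** * Cells of the rescaled lattice *)

Section binomial_histogram.
Context {R : realType}.
Implicit Types (r x : R) (N : nat).

(* The cell of [j] in the rescaling x = 2 (j - (N + 1) r) / sqrt (N + 1). Using
   [N + 1] for [N] matches the mode of the law and drops out in the limit. *)
Definition cell N r (j : nat) : set R :=
  `[2 * (j%:R - N.+1%:R * r) / Num.sqrt N.+1%:R,
    2 * (j.+1%:R - N.+1%:R * r) / Num.sqrt N.+1%:R[.

(** A point determines its cell by truncation. [Num.truncn] sends a negative [t] to 0 although such
    an [x] lies in no cell, hence the guard [0 <= t]. *)
Lemma indic_cell N r j x (t := N.+1%:R * r + x * Num.sqrt N.+1%:R / 2) :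
  \1_(cell N r j) x = ((0 <= t) && (j == Num.truncn t))%:R :> R.
Proof.
have s0 : 0 < Num.sqrt N.+1%:R :> R by rewrite sqrtr_gt0.
rewrite indicE.
suff -> : (x \in cell N r j) = (0 <= t) && (j == Num.truncn t) by [].
apply/idP/idP.
  move/set_mem; rewrite /cell /= in_itv/= ler_pdivrMr// ltr_pdivlMr// => /andP[h1 h2].
  have jt : j%:R <= t < j.+1%:R.
    by rewrite /t; set y := N.+1%:R * r in h1 h2 *; apply/andP; split; lra.
  rewrite (truncn_def jt) eqxx andbT.
  by case/andP: jt => + _; apply: le_trans.
move=> /andP[t0 /eqP ->]; apply/mem_set.
rewrite /cell /= in_itv/= ler_pdivrMr// ltr_pdivlMr//.
have /andP[] := truncn_itv t0; set T := Num.truncn t.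
by rewrite /t; set y := _ * r => h1 h2; apply/andP; split; lra.
Qed.

Lemma sum_indic_cell N r x (f : nat -> R)
    (t := N.+1%:R * r + x * Num.sqrt N.+1%:R / 2) :
  \sum_(0 <= j < N.+1) f j * \1_(cell N r j) x =
  if (0 <= t) && (Num.truncn t <= N)%N then f (Num.truncn t) else 0.
Proof.
under eq_bigr do rewrite indic_cell -/t mulr_natr.
case: (0 <= t) => /=; last by rewrite big1// => j _; rewrite mulr0n.
under eq_bigr do rewrite mulrb.
by rewrite -big_mkcond big_nat1_eq/= ltnS.
Qed.

Lemma measurable_cell N r j : measurable (cell N r j).
Proof. exact: measurable_itv. Qed.

Lemma lebesgue_measure_cell N r j :
  lebesgue_measure (cell N r j) = (2 / Num.sqrt N.+1%:R)%:E.
Proof.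
have s0 : 0 < Num.sqrt N.+1%:R :> R by rewrite sqrtr_gt0.
rewrite /cell lebesgue_measure_itv/= lte_fin ltr_pM2r ?invr_gt0//.
rewrite ltr_pM2l// ltrD2r ltr_nat ltnSn -EFinB; congr EFin.
by rewrite -mulrBl -(natr1 j); congr (_ / _); ring.
Qed.

Lemma sqrtS_ge_near (C : R) : \forall N \near \oo, C <= Num.sqrt N.+1%:R.
Proof.
have C0 : 0 < `|C| + 1 by rewrite ltr_wpDl.
have h : \forall N \near \oo, (Num.sqrt N.+1%:R)^-1 <= (`|C| + 1)^-1.
  by apply: (cvgr_le _ cvg_invr_sqrtS); rewrite invr_gt0.
apply: filterS h => N; rewrite lef_pV2 ?posrE ?sqrtr_gt0//.
by apply: le_trans; rewrite ler_wpDr// ler_norm.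
Qed.

Lemma cell_index_near r x (t := fun N => N.+1%:R * r + x * Num.sqrt N.+1%:R / 2) :
  0 < r < 1 -> \forall N \near \oo, (0 <= t N) && (Num.truncn (t N) <= N)%N.
Proof.
move=> /andP[r0 r1].
apply: filterS2 (sqrtS_ge_near (`|x| / r)) (sqrtS_ge_near (`|x| / (1 - r))).
move=> N; rewrite ler_pdivrMr// ler_pdivrMr ?subr_gt0// => h1 h2.
have s0 : 0 < Num.sqrt N.+1%:R :> R by rewrite sqrtr_gt0.
have tE : t N = Num.sqrt N.+1%:R * (Num.sqrt N.+1%:R * r + x / 2).
  by rewrite /t -{1}(@sqr_sqrtr R N.+1%:R)//; ring.
have t0 : 0 <= t N.
  rewrite tE mulr_ge0 ?(ltW s0)//; have := ler_norm (- x); rewrite normrN.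
  have := normr_ge0 x; lra.
rewrite t0/= -ltnS truncn_lt_nat// tE.
rewrite -[ltRHS](@sqr_sqrtr R N.+1%:R)// expr2 ltr_pM2l//.
have := ler_norm x; have := normr_ge0 x; rewrite mulrBr mulr1 in h2.
have : Num.sqrt N.+1%:R * r < Num.sqrt N.+1%:R by rewrite gtr_pMr.
move: (Num.sqrt _ * r) h1 h2 => sr h1 h2; lra.
Qed.

(** The expression is eventually the left end of the cell containing [x], and cells have width
    [2 / Num.sqrt N.+1%:R]. *)
Lemma cell_index_cvg r x : 0 < r < 1 ->
  2 * ((Num.truncn (N.+1%:R * r + x * Num.sqrt N.+1%:R / 2))%:R - N.+1%:R * r)
    / Num.sqrt N.+1%:R @[N --> \oo] --> x.
Proof.
move=> r01.
have hx : x - 2 * (Num.sqrt N.+1%:R)^-1 @[N --> \oo] --> x.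
  rewrite -[X in _ --> X]subr0 -[X in _ - X](mulr0 2).
  by apply: cvgB; [exact: cvg_cst|apply: cvgMl_tmp; exact: cvg_invr_sqrtS].
apply: (squeeze_cvgr _ hx (cvg_cst x)).
apply: filterS (cell_index_near x r01) => N /andP[t0 _].
have s0 : 0 < Num.sqrt N.+1%:R :> R by rewrite sqrtr_gt0.
have /andP[] := truncn_itv t0; set T := Num.truncn _; rewrite -(natr1 T).
set y := _ * r; set s := Num.sqrt _ in s0 *; move=> h1 h2.
rewrite ler_pdivrMr// ler_pdivlMr// mulrBl mulfVK ?gt_eqF//.
by apply/andP; split; lra.
Qed.

End binomial_histogram.

(** * The binomial histogram: domination and integral *)

Section de_moivre_laplace.
Context {R : realType}.
Implicit Types (r x : R) (N : nat).

Definition binomial_mode N r : nat := Num.truncn (N.+1%:R * r).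

Lemma binomial_mode_le N r : 0 < r < 1 -> (binomial_mode N r <= N)%N.
Proof.
move=> /andP[r0 r1]; rewrite -ltnS /binomial_mode.
by rewrite truncn_lt_nat ?mulr_ge0 ?(ltW r0)// gtr_pMr.
Qed.

Lemma binomial_mode_cvg r : 0 < r < 1 ->
  2 * ((binomial_mode N r)%:R - N.+1%:R * r) / Num.sqrt N.+1%:R
    @[N --> \oo] --> 0.
Proof.
(* The mode indexes the cell containing 0. *)
move=> r01; rewrite (_ : (fun N => _) = fun N =>
    2 * ((Num.truncn (N.+1%:R * r + 0 * Num.sqrt N.+1%:R / 2))%:R - N.+1%:R * r)
    / Num.sqrt N.+1%:R); first exact: cell_index_cvg.
by apply/funext => N; rewrite /binomial_mode !mul0r addr0.
Qed.

(** A step function on the line, restricted to the indices in [Q]. Dividing by the weight of the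
    mode spares any estimate of that weight. *)
Definition binomial_histogram N r (Q : pred nat) x : R :=
  \sum_(0 <= j < N.+1) (Q j)%:R *
    (binomial_pmf N r j / binomial_pmf N r (binomial_mode N r)) *
    \1_(cell N r j) x.

Lemma binomial_histogram_ge0 N r (Q : pred nat) x : 0 < r < 1 ->
  0 <= binomial_histogram N r Q x.
Proof.
move=> /andP[r0 r1]; apply: sumr_ge0 => j _.
by rewrite mulr_ge0 ?indic_ge0// mulr_ge0// divr_ge0//
  binomial_pmf_ge0 ?(ltW r0) ?(ltW r1).
Qed.

(** This is [binomial_pmf_le_mode] at the index of the cell of [x]. The bound is uniform in [N], as
    dominated convergence requires. *)
Lemma binomial_histogram_le N r (Q : pred nat) x : 0 < r < 1 ->
  binomial_histogram N r Q x <= expR 1 * expR (- (x ^+ 2 / 16)).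
Proof.
move=> r01; have /andP[r0 r1] := r01; rewrite /binomial_histogram sum_indic_cell.
have e0 : 0 <= expR 1 * expR (- (x ^+ 2 / 16)) by rewrite mulr_ge0 ?expR_ge0.
case: ifP => [/andP[t0 TN]|//].
have mN := binomial_mode_le N r01.
have M0 : 0 < N.+1%:R :> R by rewrite ltr0n.
have bm := binomial_pmf_gt0 r01 mN; have bT := binomial_pmf_gt0 r01 TN.
have mi : (binomial_mode N r)%:R <= N.+1%:R * r < (binomial_mode N r).+1%:R.
  by apply: truncn_itv; rewrite mulr_ge0 ?(ltW r0).
have mi' : (binomial_mode N r)%:R <= N.+1%:R * r <= (binomial_mode N r).+1%:R.
  by case/andP: mi => -> /ltW.
have := binomial_pmf_le_mode r01 mN TN mi'.
have := truncn_itv t0.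
move: TN bm bT mi {mi'}; set m := binomial_mode N r; set T := Num.truncn _.
move=> TN bm bT mi Ti.
rewrite -ln_div ?posrE// => hl.
have Q1 : (Q T)%:R <= 1 :> R by case: (Q T); rewrite ?ler01.
apply: (@le_trans _ _ (binomial_pmf N r T / binomial_pmf N r m)).
  by rewrite ler_piMl// divr_ge0 ?(ltW bm) ?(ltW bT).
rewrite -expRD -[leLHS]lnK ?posrE ?divr_gt0// ler_expR; apply: (le_trans hl).
rewrite ler_pdivrMr ?mulr_gt0//.
have M1 : 1 <= N.+1%:R :> R by rewrite ler1n.
have ss : Num.sqrt N.+1%:R ^+ 2 = N.+1%:R :> R by rewrite sqr_sqrtr.
move: mi Ti; rewrite -(natr1 m) -(natr1 T).
move: (Num.sqrt N.+1%:R) ss M1; move: (N.+1%:R) (m%:R) (T%:R) => M m' T' s <-.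
set y := _ * r; clear; move=> M1 /andP[m1 m2] /andP[T1 T2].
have sq (z : R) : - 2^-1 <= z -> z <= 2^-1 -> z ^+ 2 <= 4^-1.
  by clear; move=> ? ?; nra.
have h1 : (m' + 2^-1 - y) ^+ 2 <= 4^-1 by apply: sq; lra.
have [a [aE ha]] : exists a, T' + 2^-1 - y = x * s / 2 + a /\ a ^+ 2 <= 4^-1.
  exists (T' + 2^-1 - y - x * s / 2); split; first by ring.
  by move: (x * s) T1 T2 => xs T1 T2; apply: sq; lra.
rewrite aE.
(* Removing the offset [a] halves the quadratic term: variance 4 in the scale of [x] becomes 8,
   hence the 16. The squares of the two offsets, at most [4^-1] each, are absorbed in [expR 1]. *)
have : (x * s / 2) ^+ 2 <= 2 * (x * s / 2 + a) ^+ 2 + 2 * a ^+ 2.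
  by have := sqr_ge0 (x * s / 2 + 2 * a); lra.
have -> : (1 + - (x ^+ 2 / 16)) * (2 * s ^+ 2) = 2 * s ^+ 2 - (x * s / 2) ^+ 2 / 2.
  by field.
lra.
Qed.

Lemma measurable_binomial_histogram N r (Q : pred nat) :
  measurable_fun setT (binomial_histogram N r Q).
Proof.
apply: measurable_sum => j; apply: measurable_funM => //.
by apply: measurable_indic; exact: measurable_cell.
Qed.

(** All cells have the same width, so the integral is the binomial probability of [Q] up to a factor
    that does not depend on [Q]. *)
Lemma integral_binomial_histogram N r (Q : pred nat) : 0 < r < 1 ->
  (\int[lebesgue_measure]_x (binomial_histogram N r Q x)%:E =
   (2 / Num.sqrt N.+1%:R / binomial_pmf N r (binomial_mode N r) *
    \sum_(0 <= j < N.+1) (Q j)%:R * binomial_pmf N r j)%:E)%E.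
Proof.
move=> /andP[r0 r1].
under eq_integral do rewrite /binomial_histogram -sumEFin.
have c0 j : 0 <= (Q j)%:R *
    (binomial_pmf N r j / binomial_pmf N r (binomial_mode N r)).
  by rewrite mulr_ge0// divr_ge0// binomial_pmf_ge0 ?(ltW r0) ?(ltW r1).
rewrite ge0_integral_sum//=; last 2 first.
- move=> j; apply/measurable_EFinP/measurable_funM => //.
  by apply: measurable_indic; exact: measurable_cell.
- by move=> j x _; rewrite lee_fin mulr_ge0// indic_ge0.
rewrite mulr_sumr -sumEFin; apply: eq_bigr => j _.
under eq_integral do rewrite EFinM.
rewrite ge0_integralZl_EFin//=; last first.
  by apply/measurable_EFinP/measurable_indic; exact: measurable_cell.
rewrite integral_indic//=; last exact: measurable_cell.
rewrite setIT lebesgue_measure_cell -EFinM; congr EFin; ring.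
Qed.

Lemma sum_binomial_pmf N r :
  \sum_(0 <= j < N.+1) binomial_pmf N r j = 1.
Proof.
transitivity (((1 - r) + r) ^+ N); last by rewrite subrK expr1n.
rewrite exprDn big_mkord; apply: eq_bigr => j _.
by rewrite /binomial_pmf mulrC.
Qed.

End de_moivre_laplace.

(** * The de Moivre-Laplace theorem *)

Section de_moivre_laplace_limit.
Context {R : realType}.
Implicit Types (r x y : R) (N : nat).

(** Scaled to give the mode the height of the peak of the limiting density, rather than to have
    total integral 1, which is recovered only in the limit. *)
Definition normal_histogram N r (Q : pred nat) x : R :=
  normal_peak (Num.sqrt (4 * (r * (1 - r)))) * binomial_histogram N r Q x.

Lemma normal_pdf0E (v x : R) : 0 < v ->
  normal_pdf 0 (Num.sqrt v) x =
  normal_peak (Num.sqrt v) * expR (- (x ^+ 2 / (2 * v))).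
Proof.
move=> v0; rewrite normal_pdfE ?gt_eqF ?sqrtr_gt0// /normal_fun subr0.
by rewrite sqr_sqrtr ?(ltW v0)// mulNr [in RHS]mulr_natl.
Qed.

(** At a fixed [x] the histogram sees a single index, that of the cell of [x]. Its rescaling tends
    to [x], so the hypothesis on [Q] and the local limit apply to it. *)
Lemma normal_histogram_cvg r (Q : nat -> pred nat) (A : set R) x :
  0 < r < 1 ->
  (forall j : nat -> nat,
    2 * ((j N)%:R - N.+1%:R * r) / Num.sqrt N.+1%:R @[N --> \oo] --> x ->
    \forall N \near \oo, Q N (j N) = (x \in A)) ->
  normal_histogram N r (Q N) x @[N --> \oo] -->
    (x \in A)%:R * normal_pdf 0 (Num.sqrt (4 * (r * (1 - r)))) x.
Proof.
move=> r01 QA; have /andP[r0 r1] := r01.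
have v0 : 0 < 4 * (r * (1 - r)) by rewrite !mulr_gt0// subr_gt0.
pose t N := N.+1%:R * r + x * Num.sqrt N.+1%:R / 2.
pose j N := Num.truncn (t N).
have jx := cell_index_cvg (x := x) r01.
have lim : (x \in A)%:R * (normal_peak (Num.sqrt (4 * (r * (1 - r)))) *
    (binomial_pmf N r (j N) / binomial_pmf N r (binomial_mode N r)))
    @[N --> \oo] -->
    (x \in A)%:R * normal_pdf 0 (Num.sqrt (4 * (r * (1 - r)))) x.
  apply: cvgMl_tmp; rewrite normal_pdf0E//; apply: cvgMl_tmp.
  rewrite (_ : 2 * _ = 8 * (r * (1 - r))); last by ring.
  exact: binomial_pmf_ratio_cvg (binomial_mode_cvg r01).
apply: cvg_trans lim; apply: near_eq_cvg.
apply: filterS2 (QA _ jx) (cell_index_near x r01) => N QN tN.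
by rewrite /normal_histogram /binomial_histogram sum_indic_cell tN QN; ring.
Qed.

(** The point [y], of measure zero, is left out so that [A] may be a half-line ending at [y], where
    the test need not stabilize. *)
Lemma integral_normal_histogram_cvg r (Q : nat -> pred nat) (A : set R) y :
  0 < r < 1 -> measurable A ->
  (forall x (j : nat -> nat), x != y ->
    2 * ((j N)%:R - N.+1%:R * r) / Num.sqrt N.+1%:R @[N --> \oo] --> x ->
    \forall N \near \oo, Q N (j N) = (x \in A)) ->
  (\int[lebesgue_measure]_x (normal_histogram N r (Q N) x)%:E @[N --> \oo] -->
   normal_prob 0 (Num.sqrt (4 * (r * (1 - r)))) A)%E.
Proof.
move=> r01 mA QA; have /andP[r0 r1] := r01.
have v0 : 0 < 4 * (r * (1 - r)) by rewrite !mulr_gt0// subr_gt0.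
set sg := Num.sqrt _.
have p0 : 0 < normal_peak sg.
  by rewrite normal_peak_gt0// gt_eqF// sqrtr_gt0.
have p8 : 0 < normal_peak (Num.sqrt 8 : R).
  by rewrite normal_peak_gt0// gt_eqF// sqrtr_gt0.
rewrite /normal_prob integral_mkcond.
(* The bound of [binomial_histogram_le] is a multiple of the normal density of variance 8; [c]
   collects the two peaks and [expR 1]. *)
pose c := normal_peak sg * expR 1 / normal_peak (Num.sqrt 8 : R).
pose g x := (c%:E * (normal_pdf 0 (Num.sqrt 8) x)%:E)%E.
have := @dominated_convergence _ _ _ (@lebesgue_measure R) setT measurableT
  (fun N x => (normal_histogram N r (Q N) x)%:E)
  ((fun x => (normal_pdf 0 sg x)%:E) \_ A) g.
case=> //.
- move=> N; apply/measurable_EFinP/measurable_funM => //.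
  exact: measurable_binomial_histogram.
- apply/measurable_restrict => //; apply/measurable_EFinP/measurable_funTS.
  exact: measurable_normal_pdf.
- exists [set y]; split.
  + exact: measurable_set1.
  + exact: lebesgue_measure_set1.
  move=> x /= h; apply/eqP; apply: contrapT => /negP xy; apply: h => _.
  rewrite patchE.
  have -> : (if x \in A then (normal_pdf 0 sg x)%:E else point) =
      ((x \in A)%:R * normal_pdf 0 sg x)%:E.
    by case: (x \in A); rewrite ?mul1r ?mul0r.
  apply: cvg_EFin; first exact: nearW.
  by apply: normal_histogram_cvg => // j; exact: QA.
- exact/integrableZl/integrable_normal_pdf.
- apply: aeW => x N _ /=; rewrite lee_fin ger0_norm; last first.
    by rewrite mulr_ge0 ?(ltW p0)// binomial_histogram_ge0.
  rewrite normal_pdf0E// /c mulrA mulfVK ?gt_eqF// -mulrA.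
  rewrite ler_pM2l//; apply: le_trans (binomial_histogram_le _ _ _ r01) _.
  by rewrite (_ : 2 * 8 = 16 :> R)//; ring.
Qed.

(** The integral of the histogram is [a N] times the sum. For the test that always holds the sum is
    1, so [a N] tends to 1, and dividing by it gives the general case. *)
Lemma binomial_sum_cvg r (Q : nat -> pred nat) (A : set R) y :
  0 < r < 1 -> measurable A ->
  (forall x (j : nat -> nat), x != y ->
    2 * ((j N)%:R - N.+1%:R * r) / Num.sqrt N.+1%:R @[N --> \oo] --> x ->
    \forall N \near \oo, Q N (j N) = (x \in A)) ->
  \sum_(0 <= j < N.+1) (Q N j)%:R * binomial_pmf N r j @[N --> \oo] -->
   fine (normal_prob 0 (Num.sqrt (4 * (r * (1 - r)))) A).
Proof.
move=> r01 mA QA; have /andP[r0 r1] := r01.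
have v0 : 0 < 4 * (r * (1 - r)) by rewrite !mulr_gt0// subr_gt0.
set sg := Num.sqrt _.
have p0 : 0 < normal_peak sg.
  by rewrite normal_peak_gt0// gt_eqF// sqrtr_gt0.
pose a N := normal_peak sg *
  (2 / Num.sqrt N.+1%:R / binomial_pmf N r (binomial_mode N r)).
have intE N (P : pred nat) :
    (\int[lebesgue_measure]_x (normal_histogram N r P x)%:E =
    (a N * \sum_(0 <= j < N.+1) (P j)%:R * binomial_pmf N r j)%:E)%E.
  rewrite /normal_histogram; under eq_integral do rewrite EFinM.
  rewrite ge0_integralZl_EFin//=.
  - by rewrite integral_binomial_histogram// -EFinM /a -[in RHS]mulrA.
  - by move=> x _; rewrite lee_fin binomial_histogram_ge0.
  - by apply/measurable_EFinP; exact: measurable_binomial_histogram.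
  - exact: ltW.
have aT : a N @[N --> \oo] --> (1 : R).
  apply: (fine_cvg (f := fun N => (a N)%:E)).
  have -> : (fun N => (a N)%:E) = (fun N =>
      \int[lebesgue_measure]_x (normal_histogram N r xpredT x)%:E)%E.
    apply/funext => N; rewrite intE; under eq_bigr do rewrite mul1r.
    by rewrite sum_binomial_pmf mulr1.
  rewrite -(@probability_setT _ _ _ (normal_prob 0 sg)).
  apply: (@integral_normal_histogram_cvg _ (fun=> xpredT) _ 0) => //.
  by move=> x j _ _; apply: nearW => N; rewrite in_setT.
have aQ := integral_normal_histogram_cvg r01 mA QA.
have a0 N : a N != 0.
  rewrite gt_eqF// mulr_gt0// !divr_gt0 ?sqrtr_gt0//.
  by rewrite binomial_pmf_gt0// binomial_mode_le.
have {}aQ : a N * \sum_(0 <= j < N.+1) (Q N j)%:R * binomial_pmf N r j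
    @[N --> \oo] --> fine (normal_prob 0 sg A).
  apply: (fine_cvg (f := fun N =>
    (a N * \sum_(0 <= j < N.+1) (Q N j)%:R * binomial_pmf N r j)%:E)).
  rewrite fineK ?fin_num_measure//.
  by under eq_fun do rewrite -intE.
rewrite -[X in _ --> X]divr1.
under eq_fun => N do
  rewrite -[\sum_(_ <= _ < _) _](mulKf (a0 N)) mulrC.
by apply: cvgM => //; apply: cvgV; rewrite ?oner_neq0.
Qed.

End de_moivre_laplace_limit.

(** * Real-valued probabilities and total probability *)

Section real_valued_probability.
Context {d : measure_display} {T : measurableType d} {R : realType}.
Variable P : probability T R.
Implicit Types A B Y : set T.

(** Real values let [ring] and [lra] handle sums and products of probabilities. *)
Definition Pr A : R := fine (P A).

Lemma PrE A : measurable A -> P A = (Pr A)%:E.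
Proof. by move=> mA; rewrite fineK ?fin_num_measure. Qed.

Lemma Pr_ge0 A : 0 <= Pr A.
Proof. exact: fine_ge0. Qed.

Lemma Pr_setT : Pr setT = 1.
Proof. by rewrite /Pr probability_setT. Qed.

Lemma Pr_set0 : Pr set0 = 0.
Proof. by rewrite /Pr measure0. Qed.

Lemma Pr_le A B : measurable A -> measurable B -> A `<=` B -> Pr A <= Pr B.
Proof.
move=> mA mB AB; rewrite -lee_fin. rewrite -(PrE mA) -(PrE mB).
by apply: le_measure => //; exact/mem_set.
Qed.

Lemma Pr_setU A B : measurable A -> measurable B -> A `&` B = set0 ->
  Pr (A `|` B) = Pr A + Pr B.
Proof.
move=> mA mB AB; apply: EFin_inj.
rewrite EFinD -!PrE//; first by rewrite measureU.
exact: measurableU.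
Qed.

Lemma Pr_setI1 A B : measurable A -> measurable B -> Pr B = 1 ->
  Pr (A `&` B) = Pr A.
Proof.
move=> mA mB B1; have mC := measurableC mB.
have hC : Pr (~` B) = 0.
  have : Pr (B `|` ~` B) = Pr B + Pr (~` B) by rewrite Pr_setU ?setICr.
  by rewrite setUv Pr_setT B1; lra.
have : Pr A = Pr (A `&` B) + Pr (A `&` ~` B).
  rewrite -Pr_setU; [|exact: measurableI|exact: measurableI|].
  - by rewrite -setIUr setUv setIT.
  - by rewrite setIACA setICr setI0.
have : Pr (A `&` ~` B) <= 0.
  by rewrite -hC Pr_le//; exact: measurableI.
by have := Pr_ge0 (A `&` ~` B); lra.
Qed.

Lemma Pr_ae A B : measurable A -> measurable B ->
  (\forall t \ae P, A t <-> B t) -> Pr A = Pr B.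
Proof.
move=> mA mB [N [mN N0 sN]]; have mC := measurableC mN.
have N1 : Pr (~` N) = 1.
  have : Pr (N `|` ~` N) = Pr N + Pr (~` N) by rewrite Pr_setU ?setICr.
  by rewrite setUv Pr_setT /Pr N0/= add0r.
have AB t : ~ N t -> (A t <-> B t).
  by move=> Nt; apply: contrapT => h; exact/Nt/sN.
rewrite -(Pr_setI1 mA mC N1) -(Pr_setI1 mB mC N1); congr Pr.
by apply/seteqP; split=> t [h Nt]; split => //; apply/(AB t Nt).
Qed.

Section partition.
Variables (V : eqType) (Z : T -> V).

Lemma Pr_mem_seq Y (s : seq V) : uniq s -> measurable Y ->
  (forall z, z \in s -> measurable (Z @^-1` [set z])) ->
  measurable [set t | Z t \in s] /\
  Pr (Y `&` [set t | Z t \in s]) = \sum_(z <- s) Pr (Y `&` Z @^-1` [set z]).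
Proof.
move=> + mY; elim: s => [_ _|z s IH].
  by rewrite big_nil (_ : [set t | _] = set0) ?setI0 ?Pr_set0// -subset0.
move=> /= /andP[zs us] mZ.
have mz : measurable (Z @^-1` [set z]) by apply: mZ; rewrite mem_head.
have [mU ms] : _ /\ _ := IH us (fun z' h => mZ z' (mem_behead (s := z :: s) h)).
have E : [set t | Z t \in z :: s] = Z @^-1` [set z] `|` [set t | Z t \in s].
  apply/seteqP; split=> t /=; rewrite in_cons.
    by case/orP => [/eqP|]; [left|right].
  by case=> [->|->]; rewrite ?eqxx ?orbT.
rewrite E; split; first exact: measurableU.
rewrite setIUr Pr_setU ?big_cons ?ms//; [exact: measurableI..|].
rewrite setIACA setIid; apply/seteqP; split => // t [_ [/= Zz]].
by rewrite Zz (negbTE zs).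
Qed.

(** The values in [s] have to carry the full mass without exhausting [Z]: [K n.+1] may leave the
    admissible indices on a null event. *)
Lemma total_probability Y (s : seq V) : uniq s -> measurable Y ->
  (forall z, z \in s -> measurable (Z @^-1` [set z])) ->
  \sum_(z <- s) Pr (Z @^-1` [set z]) = 1 ->
  Pr Y = \sum_(z <- s) Pr (Y `&` Z @^-1` [set z]).
Proof.
move=> us mY mZ s1; have [mU <-] := Pr_mem_seq us mY mZ.
rewrite Pr_setI1//; have [_] := Pr_mem_seq us measurableT mZ.
by rewrite setTI => ->; under eq_bigr do rewrite setTI.
Qed.

End partition.

Lemma total_probability_fin (V : finType) (Z : T -> V) Y : measurable Y ->
  (forall z, measurable (Z @^-1` [set z])) ->
  Pr Y = \sum_z Pr (Y `&` Z @^-1` [set z]).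
Proof.
move=> mY mZ; have [_] := Pr_mem_seq (enum_uniq V) mY (fun z _ => mZ z).
rewrite big_enum => <-; congr Pr; apply/seteqP; split=> t; last by case.
by move=> Yt; split => //=; rewrite mem_enum.
Qed.

End real_valued_probability.

(** * Independence of the past from the later draws *)

Section elephant.
Context {d : measure_display} {T : measurableType d} {R : realType}.
Variables (P : probability T R) (p : R) (m : nat).
Variables (X : nat -> {RV P >-> R}) (K : nat -> {RV P >-> nat}).
Variable B : nat -> {RV P >-> bool}.
Hypotheses (p_gt0 : 0 < p) (p_lt1 : p < 1) (m_ge1 : (1 <= m)%N).
Hypothesis erw : elephant_first_steps p m X K B.
Hypotheses (X1_plus : P (X 1%N @^-1` [set 1]) = p%:E)
  (X1_minus : P (X 1%N @^-1` [set -1]) = (1 - p)%:E).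

Local Notation source := (unit + (nat + nat))%type.

Definition source_events (i : source) : set (set T) :=
  match i with
  | inl _ => generated (X 1%N)
  | inr (inl n) => generated (K n.+1)
  | inr (inr n) => generated (B n.+1)
  end.

(* The draws made after step [n.+1] are those of index at least [n]. *)
Definition future (n : nat) (i : source) : bool :=
  match i with
  | inl _ => false
  | inr (inl l) => (n <= l)%N
  | inr (inr l) => (n <= l)%N
  end.

(** Independence is recorded as product formulas against finitely many later draws, a form that
    passes from one step to the next. *)
Definition indep_future (n : nat) (A : set T) : Prop :=
  measurable A /\
  forall (J : {fset source}) (F : source -> set T),
    (forall i, i \in J -> future n i) ->
    (forall i, i \in J -> source_events i (F i)) ->
    Pr P (A `&` \bigcap_(i in [set` J]) F i) =
    Pr P A * \prod_(i <- J) Pr P (F i).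

Lemma generated_preimage (d' : measure_display) (T' : measurableType d')
    (f : T -> T') (E : set T') : measurable E -> generated f (f @^-1` E).
Proof. by move=> mE; exists E => //; rewrite setTI. Qed.

Lemma measurable_source_events i E : source_events i E -> measurable E.
Proof.
by case: i => [u|[n|n]] [C mC <-]; rewrite setTI; exact: measurable_funPTI.
Qed.

Lemma Pr_bigcap_sources (J : {fset source}) (F : source -> set T) :
  (forall i, i \in J -> source_events i (F i)) ->
  Pr P (\bigcap_(i in [set` J]) F i) = \prod_(i <- J) Pr P (F i).
Proof.
move=> JF; rewrite /Pr (efs_indep erw (J := J) (A := F))// big_seq.
rewrite (eq_bigr (fun i => (Pr P (F i))%:E)) -?big_seq ?prodEFin// => i iJ.
by rewrite PrE//; exact/measurable_source_events/JF.
Qed.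

Lemma measurable_bigcap_sources (J : {fset source}) (F : source -> set T) :
  (forall i, i \in J -> source_events i (F i)) ->
  measurable (\bigcap_(i in [set` J]) F i).
Proof.
move=> JF; apply: fin_bigcap_measurable => // i /= /JF.
exact: measurable_source_events.
Qed.

Lemma indep_future_first (E : set R) : measurable E ->
  indep_future 0 (X 1%N @^-1` E).
Proof.
move=> mE; split; first exact: measurable_funPTI.
move=> J F Jf JF.
have JX : (inl tt : source) \notin J by apply/negP => /Jf.
pose F' (i : source) := if i is inl _ then X 1%N @^-1` E else F i.
have FF i : i \in J -> F' i = F i by move=> iJ; have := Jf _ iJ; case: i {iJ}.
have <- : \bigcap_(i in [set` J]) F' i = \bigcap_(i in [set` J]) F i.
  exact: eq_bigcapr.
rewrite -(bigcap_fsetU1 F' (inl tt)) Pr_bigcap_sources.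
  rewrite big_fsetU1//=; congr (_ * _).
  by rewrite big_seq [RHS]big_seq; apply: eq_bigr => i /FF ->.
move=> i /fset1UP [-> /=|iJ]; first exact: generated_preimage.
by rewrite FF//; exact: JF.
Qed.

(** The draws [K n.+1] and [B n.+1] are themselves future at level [n]; adjoining their indices to
    [J] gives an instance of [indep_future n A]. *)
Lemma indep_future_draw n A k b (J : {fset source}) (F : source -> set T) :
  indep_future n A ->
  (forall i, i \in J -> future n.+1 i) ->
  (forall i, i \in J -> source_events i (F i)) ->
  Pr P (A `&` (K n.+1 @^-1` [set k] `&` (B n.+1 @^-1` [set b] `&`
    \bigcap_(i in [set` J]) F i))) =
  Pr P A * (Pr P (K n.+1 @^-1` [set k]) * (Pr P (B n.+1 @^-1` [set b]) *
    \prod_(i <- J) Pr P (F i))).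
Proof.
move=> [mA iA] Jf JF.
pose iK : source := inr (inl n); pose iB : source := inr (inr n).
have JB : iB \notin J by apply/negP => /Jf /=; rewrite ltnn.
have JK : iK \notin (iB |` J)%fset.
  by rewrite !inE negb_or/=; apply/negP => /Jf /=; rewrite ltnn.
pose F' (i : source) := if i == iK then K n.+1 @^-1` [set k] else
  if i == iB then B n.+1 @^-1` [set b] else F i.
have FF i : i \in J -> F' i = F i.
  move=> iJ; rewrite /F'; case: eqP => [iE|_].
    by move: JK; rewrite -iE !inE iJ orbT.
  by case: eqP => // iE; move: JB; rewrite -iE iJ.
have FK : F' iK = K n.+1 @^-1` [set k] by rewrite /F' eqxx.
have FB : F' iB = B n.+1 @^-1` [set b] by rewrite /F' eqxx.
have := iA (iK |` (iB |` J))%fset F'.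
rewrite !bigcap_fsetU1 !big_fsetU1//= FK FB.
rewrite (eq_bigcapr (G := F)); last by move=> i /= /FF.
rewrite (_ : \prod_(j <- J) Pr P (F' j) = \prod_(j <- J) Pr P (F j)); last first.
  by rewrite big_seq [RHS]big_seq; apply: eq_bigr => i /FF ->.
apply.
- move=> i /fset1UP [-> /=|/fset1UP [-> /=|/Jf]]; rewrite ?leqnn//.
  by case: i => [//|[l|l]] /= /ltnW.
- move=> i /fset1UP [->|/fset1UP [->|iJ]].
  + by rewrite FK; exact: generated_preimage.
  + by rewrite FB; exact: generated_preimage.
  + by rewrite FF//; exact: JF.
Qed.

Lemma Pr_repeat n b : Pr P (B n.+1 @^-1` [set b]) = if b then p else 1 - p.
Proof.
by rewrite /Pr; case: b; [rewrite (efs_repeat erw)|rewrite (efs_reverse erw)].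
Qed.

Lemma Pr_index n k : (1 <= k <= minn n.+1 m)%N ->
  Pr P (K n.+1 @^-1` [set k]) = (minn n.+1 m)%:R^-1.
Proof. by move=> kn; rewrite /Pr (efs_index erw). Qed.

Lemma minn_gt0 n : (0 < minn n.+1 m)%N.
Proof. by rewrite leq_min/=. Qed.

Lemma sum_Pr_index n :
  \sum_(1 <= k < (minn n.+1 m).+1) Pr P (K n.+1 @^-1` [set k]) = 1.
Proof.
have := minn_gt0 n; set M := minn n.+1 m => M0.
rewrite big_nat (eq_bigr (fun=> M%:R^-1)); last first.
  by move=> k /andP[k1 kM]; rewrite Pr_index// k1 -ltnS.
rewrite -big_nat sumr_const_nat subn1/= -[LHS]mulr_natr mulVf//.
by rewrite pnatr_eq0 -lt0n.
Qed.

(** The conditional probability that step [n.+2] falls in [E] when the remembered steps have the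
    values [w]. *)
Definition step_prob (n : nat) (w : nat -> R) (E : set R) : R :=
  \sum_(1 <= k < (minn n.+1 m).+1) (minn n.+1 m)%:R^-1 *
    (p * (w k \in E)%:R + (1 - p) * (- w k \in E)%:R).

(** On [A] the memory is the deterministic [w], so step [n.+2] is almost surely a function of
    [K n.+1] and [B n.+1] alone; summing over their values gives both claims. *)
Lemma indep_future_step n A (w : nat -> R) (E : set R) : measurable E ->
  indep_future n A ->
  (forall t k, A t -> (1 <= k <= minn n.+1 m)%N -> X k t = w k) ->
  indep_future n.+1 (A `&` X n.+2 @^-1` E) /\
  Pr P (A `&` X n.+2 @^-1` E) = Pr P A * step_prob n w E.
Proof.
move=> mE iA Aw; have [mA _] := iA.
have mAX : measurable (A `&` X n.+2 @^-1` E).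
  by apply: measurableI => //; exact: measurable_funPTI.
(* With the later draws [F] carried along, one formula yields both claims: the empty family gives
   the probability, a general one the independence. *)
suff core (J : {fset source}) (F : source -> set T) :
    (forall i, i \in J -> future n.+1 i) ->
    (forall i, i \in J -> source_events i (F i)) ->
    Pr P (A `&` X n.+2 @^-1` E `&` \bigcap_(i in [set` J]) F i) =
    Pr P A * step_prob n w E * \prod_(i <- J) Pr P (F i).
  have eq0 : Pr P (A `&` X n.+2 @^-1` E) = Pr P A * step_prob n w E.
    have := core fset0 (fun=> setT); rewrite big_seq_fset0 mulr1 => <- //.
    by rewrite set_fset0 bigcap_set0 setIT.
  by split => //; split => // J F Jf JF; rewrite eq0 core.
move=> Jf JF; have mF := measurable_bigcap_sources JF.
set FF := \bigcap_(i in _) _ in mF *.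
have mK k : measurable (K n.+1 @^-1` [set k]) by exact: measurable_funPTI.
have mB b : measurable (B n.+1 @^-1` [set b]) by exact: measurable_funPTI.
rewrite (total_probability (Z := K n.+1) (s := index_iota 1 (minn n.+1 m).+1)).
- rewrite /step_prob mulr_sumr mulr_suml big_nat [RHS]big_nat.
  apply: eq_bigr => k /andP[k1]; rewrite ltnS => kM.
  rewrite (total_probability (Z := B n.+1) (s := [:: true; false]))//.
  + have E1 b : Pr P (A `&` X n.+2 @^-1` E `&` FF `&` K n.+1 @^-1` [set k] `&`
          B n.+1 @^-1` [set b]) =
        ((if b then w k else - w k) \in E)%:R * (Pr P A *
          ((minn n.+1 m)%:R^-1 * ((if b then p else 1 - p) *
            \prod_(i <- J) Pr P (F i)))).
      rewrite -(Pr_repeat n) -(@Pr_index n k) ?k1//.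
      rewrite -(indep_future_draw k b iA Jf JF) -/FF.
      have Xk t : A t -> K n.+1 t = k -> B n.+1 t = b ->
          X n.+2 t = if b then w k else - w k.
        move=> At Kk Bb; rewrite (efs_step erw)// Bb Kk (Aw t)//.
        by rewrite k1.
      case: (boolP (_ \in E)) => [/set_mem wE|/negP wE].
        rewrite mul1r; congr Pr; apply/seteqP; split=> t /=.
          by move=> [[[[? ?] ?] ?] ?]; split.
        by move=> [At [Kk [Bb Ft]]]; split=> //; split=> //; split=> //;
          split => //; rewrite (Xk t).
      rewrite mul0r (_ : _ `&` _ = set0) ?Pr_set0// -subset0 => t /=.
      move=> [[[[At XE] Ft] Kk] Bb]; apply: wE; apply/mem_set.
      by rewrite -(Xk t).
    by rewrite big_cons big_seq1 !E1; ring.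
  + by do ![apply: measurableI => //].
  + by rewrite big_cons big_seq1 !Pr_repeat; ring.
- exact: iota_uniq.
- exact: measurableI.
- by move=> k _; exact: mK.
- exact: sum_Pr_index.
Qed.

Lemma indep_future_setU n A A' : indep_future n A -> indep_future n A' ->
  A `&` A' = set0 -> indep_future n (A `|` A').
Proof.
move=> [mA iA] [mA' iA'] AA; split=> [|J F Jf JF]; first exact: measurableU.
have mF := measurable_bigcap_sources JF.
rewrite setIUl !Pr_setU//; [|exact: measurableI..|]; last first.
  by rewrite setIACA AA set0I.
by rewrite iA// iA'//; ring.
Qed.

Lemma indep_future_set0 n : indep_future n set0.
Proof. by split=> // J F _ _; rewrite set0I Pr_set0 mul0r. Qed.

(** * Paths of the first [m] steps *)

Definition sgb (b : bool) : R := if b then 1 else -1.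

Implicit Type o : {ffun 'I_m -> bool}.

Definition path_event (n : nat) o : set T :=
  [set t | forall i : 'I_m, (i < n)%N -> X i.+1 t = sgb (o i)].

(* Meaningful for [1 <= k <= m] only. *)
Definition path_step o (k : nat) : R :=
  if insub k.-1 is Some i then sgb (o i) else 0.

Lemma path_stepS o (i : 'I_m) : path_step o i.+1 = sgb (o i).
Proof. by rewrite /path_step/= valK. Qed.

Lemma path_event_step n o t k : path_event n.+1 o t ->
  (1 <= k <= minn n.+1 m)%N -> X k t = path_step o k.
Proof.
move=> ot; rewrite leq_min => /andP[]; case: k => // k _ /andP[kn km].
by have := ot (Ordinal km) kn; rewrite -path_stepS.
Qed.

(** By induction: before step [m] the memory is the whole past, which the path event prescribes. *)
Lemma indep_future_path n o : (n < m)%N -> indep_future n (path_event n.+1 o).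
Proof.
elim: n => [|n IH] nm.
  rewrite (_ : path_event _ _ = X 1%N @^-1` [set sgb (o (Ordinal nm))]).
    by apply: indep_future_first; exact: measurable_set1.
  apply/seteqP; split=> t /=; first by move=> /(_ (Ordinal nm)); exact.
  move=> X1 i; rewrite ltnS leqn0 => /eqP i0.
  by rewrite i0 X1; congr (sgb (o _)); exact: val_inj.
have -> : path_event n.+2 o =
    path_event n.+1 o `&` X n.+2 @^-1` [set sgb (o (Ordinal nm))].
  apply/seteqP; split=> t /=.
    move=> ot; split=> [i ilt|]; first by apply: ot; rewrite ltnW.
    exact: (ot (Ordinal nm)).
  move=> [ot Xn] i; rewrite ltnS leq_eqVlt => /orP[/eqP i0|/ot//].
  by rewrite i0 Xn; congr (sgb (o _)); exact: val_inj.
apply: (proj1 (indep_future_step (w := path_step o) _ (IH (ltnW nm)) _)).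
  exact: measurable_set1.
by move=> t k; exact: path_event_step.
Qed.

Definition minuses o : nat := (\sum_(i < m) ~~ o i)%N.

(** The number [r k] of the theorem. *)
Definition plus_prob (k : nat) : R :=
  ((m%:R - k%:R) * p + k%:R * (1 - p)) / m%:R.

Lemma sgb_eq1 b : (sgb b \in [set 1]) = b.
Proof.
case: b; first by apply/mem_set.
apply/negbTE/negP => /set_mem /= /eqP.
by rewrite /sgb eq_sym -addr_eq0 -mulr2n pnatr_eq0.
Qed.

Lemma opp_sgb b : - sgb b = sgb (~~ b).
Proof. by case: b; rewrite /sgb//= opprK. Qed.

(** Once [m <= n.+1] the memory is full, and a uniform pick from it yields a plus by repeating a
    plus or reversing a minus. *)
Lemma step_prob_path n o : (m <= n.+1)%N ->
  step_prob n (path_step o) [set 1] = plus_prob (minuses o) /\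
  step_prob n (path_step o) (~` [set 1]) = 1 - plus_prob (minuses o).
Proof.
move=> mn; rewrite /step_prob (minn_idPr mn) !big_add1/= !big_mkord.
have m0 : m%:R != 0 :> R by rewrite pnatr_eq0 -lt0n.
have E : \sum_(i < m) m%:R^-1 * (p + (~~ o i)%:R * (1 - 2 * p)) =
    plus_prob (minuses o).
  rewrite -mulr_sumr big_split/= -mulr_suml -natr_sum -/(minuses o).
  by rewrite sumr_const card_ord -mulr_natr /plus_prob; field.
rewrite -E; split.
  apply: eq_bigr => i _; rewrite path_stepS opp_sgb !sgb_eq1.
  by case: (o i) => /=; congr (_ * _); ring.
have S1 : \sum_(i < m) m%:R^-1 = 1 :> R.
  by rewrite sumr_const card_ord -[LHS]mulr_natr mulVf.
transitivity (\sum_(i < m) m%:R^-1 -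
    \sum_(i < m) m%:R^-1 * (p + (~~ o i)%:R * (1 - 2 * p)) : R); last by rewrite S1.
rewrite -sumrB; apply: eq_bigr => i _; rewrite path_stepS opp_sgb !in_setC.
by rewrite !sgb_eq1; case: (o i) => /=; ring.
Qed.

(** * Binomial law of the later pluses *)

Definition plus_count (N : nat) (t : T) : nat :=
  (\sum_(i < N) (X (m + i).+1 t == 1%R))%N.

(** Whatever is not a plus goes to the complement of [[set 1]], so the decomposition holds surely,
    whereas steps are 1 or -1 only almost surely. *)
Lemma plus_countS N j :
  [set t | plus_count N.+1 t = j] =
  ([set t | plus_count N t = j] `&` X (m + N).+1 @^-1` (~` [set 1])) `|`
  ((if j is j'.+1 then [set t | plus_count N t = j'] else set0)
    `&` X (m + N).+1 @^-1` [set 1]).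
Proof.
apply/seteqP; split=> t /=; rewrite /plus_count big_ord_recr/=.
  case: eqP => X1 /=; last by rewrite addn0; left.
  by rewrite addn1 => <-; right.
case=> [[<- /eqP/negbTE ->]|[]]; first by rewrite addn0.
by case: j => // j /= <- ->; rewrite eqxx addn1.
Qed.

Lemma measurable_plus_count N j : measurable [set t | plus_count N t = j].
Proof.
elim: N j => [|N IH] j.
  rewrite /plus_count; under eq_set do rewrite big_ord0.
  by case: j => [|j]; [rewrite (_ : [set _ | _] = setT)//|
    rewrite (_ : [set _ | _] = set0)//]; apply/seteqP; split.
rewrite plus_countS; apply: measurableU; apply: measurableI => //.
- apply: measurable_funPTI; by apply: measurableC; exact: measurable_set1.
- by case: j.
Qed.

(** Pascal's rule, in the form that matches [plus_countS]. *)
Lemma binomial_pmfS N (r : R) j : binomial_pmf N.+1 r j =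
  binomial_pmf N r j * (1 - r) +
  (if j is j'.+1 then binomial_pmf N r j' else 0) * r.
Proof.
rewrite /binomial_pmf /unstable.onem; case: j => [|j].
  by rewrite !bin0 !subn0 mul0r addr0 !expr0 !mul1r exprS mulrC.
rewrite binS subSS; have [jN|Nj] := ltnP j N.
  have -> : (N - j = (N - j.+1).+1)%N by lia.
  by rewrite mulrnDr !exprS -!(mulr_natr (_ * _)); ring.
by rewrite bin_small ?ltnS// add0n mulr0n mul0r add0r exprS -!(mulr_natr (_ * _)); ring.
Qed.

(** The two claims are proved together, since each further step uses the independence of the event
    so far. The memory remains [path_step o], so the probability of a plus never changes. *)
Lemma Pr_path_plus_count N j o :
  indep_future (m.-1 + N) (path_event m o `&` [set t | plus_count N t = j]) /\
  Pr P (path_event m o `&` [set t | plus_count N t = j]) =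
  Pr P (path_event m o) * binomial_pmf N (plus_prob (minuses o)) j.
Proof.
elim: N j => [|N IH] j.
  have ip : indep_future m.-1 (path_event m o).
    by rewrite -{2}(prednK m_ge1); apply: indep_future_path; rewrite prednK.
  rewrite addn0 /plus_count; under eq_set do rewrite big_ord0.
  case: j => [|j].
    rewrite (_ : [set _ | _] = setT) ?setIT; last by apply/seteqP; split.
    by rewrite /binomial_pmf bin0 !expr0 mulr1 mulr1n mulr1.
  rewrite (_ : [set _ | _] = set0) ?setI0; last by apply/seteqP; split.
  rewrite /binomial_pmf bin0n mulr0n mulr0 Pr_set0.
  by split=> //; exact: indep_future_set0.
(* [indep_future n] is used for events about the steps up to [n.+1], hence [m.-1] in place of
   [m]. *)
have E : ((m + N).+1 = (m.-1 + N).+2)%N by lia.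
have sub t k : path_event m o t -> (1 <= k <= minn (m.-1 + N).+1 m)%N ->
    X k t = path_step o k.
  move=> ot /andP[k1]; rewrite leq_min => /andP[_ km].
  apply: (@path_event_step m.-1); rewrite prednK//.
  by rewrite k1 minnn.
have mN : (m <= (m.-1 + N).+1)%N by lia.
have [sp1 spC] := step_prob_path o mN.
rewrite plus_countS setIUr !setIA E addnS binomial_pmfS mulrDr.
have [iC pC] := IH j.
have [iC' pC'] := indep_future_step (w := path_step o)
  (measurableC (measurable_set1 (1 : R))) iC (fun t k h => sub t k (proj1 h)).
have [i1 p1] : indep_future (m.-1 + N) (path_event m o `&`
      (if j is j'.+1 then [set t | plus_count N t = j'] else set0)) /\
    Pr P (path_event m o `&`
      (if j is j'.+1 then [set t | plus_count N t = j'] else set0)) =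
    Pr P (path_event m o) *
      (if j is j'.+1 then binomial_pmf N (plus_prob (minuses o)) j' else 0).
  case: j {iC pC iC' pC'} => [|j //].
  by rewrite setI0 Pr_set0 mulr0; split=> //; exact: indep_future_set0.
have [i1' p1'] := indep_future_step (w := path_step o)
  (measurable_set1 (1 : R)) i1 (fun t k h => sub t k (proj1 h)).
have dis : (path_event m o `&` [set t | plus_count N t = j] `&`
      X (m.-1 + N).+2 @^-1` (~` [set 1])) `&`
    (path_event m o `&`
      (if j is j'.+1 then [set t | plus_count N t = j'] else set0) `&`
      X (m.-1 + N).+2 @^-1` [set 1]) = set0.
  by rewrite -subset0 => t [[_ X1] [_ /X1]].
split; first exact: indep_future_setU.
rewrite Pr_setU//; [|by case: iC'|by case: i1'].
by rewrite pC' p1' pC p1 sp1 spC !mulrA.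
Qed.

(** * Almost sure signs and the law of the position *)

Definition pm_path (t : T) : Prop := forall n, X n.+1 t = 1 \/ X n.+1 t = -1.

Lemma ae_Pr1 (S : set T) : measurable S -> Pr P S = 1 -> \forall t \ae P, S t.
Proof.
move=> mS S1; exists (~` S); split => //; first exact: measurableC.
by rewrite probability_setC// PrE// S1 -EFinB subrr.
Qed.

(** Almost surely the first step is a sign and all the indices drawn are admissible; strong
    induction then propagates the sign, reversals included. *)
Lemma ae_pm_path : \forall t \ae P, pm_path t.
Proof.
have ae1 : \forall t \ae P, (X 1%N @^-1` [set 1] `|` X 1%N @^-1` [set -1]) t.
  apply: ae_Pr1.
    by apply: measurableU; apply: measurable_funPTI; exact: measurable_set1.
  rewrite Pr_setU; [|apply: measurable_funPTI; exact: measurable_set1..|].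
    by rewrite /Pr X1_plus X1_minus/=; ring.
  rewrite -subset0 => t /= [-> /eqP].
  by rewrite -addr_eq0 -mulr2n pnatr_eq0.
have aeK : \forall t \ae P, forall n, K n.+1 t \in index_iota 1 (minn n.+1 m).+1.
  apply: ae_foralln => n.
  have mK k : measurable (K n.+1 @^-1` [set k]) by exact: measurable_funPTI.
  have [mU pU] := @Pr_mem_seq _ _ _ P _ (K n.+1) setT
    (index_iota 1 (minn n.+1 m).+1) (iota_uniq _ _) measurableT (fun k _ => mK k).
  apply: (ae_Pr1 mU); move: pU; rewrite setTI => ->.
  by under eq_bigr do rewrite setTI; exact: sum_Pr_index.
apply: filterS2 ae1 aeK => t X1 Kt n.
elim/ltn_ind: n => -[|n] IH; first by case: X1 => ->; [left|right].
have := Kt n; rewrite mem_index_iota ltnS leq_min => /andP[k1 /andP[kn _]].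
rewrite (efs_step erw)//.
have : X (K n.+1 t) t = 1 \/ X (K n.+1 t) t = -1.
  by rewrite -(prednK k1); apply: IH; rewrite prednK.
by case: (B n.+1 t) => -[] ->; rewrite ?opprK; [left|right|right|left].
Qed.

(** Defined surely, so that its finitely many fibres partition [T]; on [pm_path] they coincide with
    the events [path_event m o]. *)
Definition signs (t : T) : {ffun 'I_m -> bool} := [ffun i : 'I_m => X i.+1 t == 1].

Lemma measurable_signs o : measurable (signs @^-1` [set o]).
Proof.
rewrite (_ : _ @^-1` _ = \bigcap_(i in [set: 'I_m])
    (X i.+1 @^-1` (if o i then [set 1] else ~` [set 1]))).
  apply: fin_bigcap_measurable => // i _; apply: measurable_funPTI.
  by case: (o i); [|apply: measurableC]; exact: measurable_set1.
apply/seteqP; split=> t /=.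
  by move=> <- i _ /=; rewrite ffunE; case: eqP.
move=> h; apply/ffunP => i; rewrite ffunE; have := h i Logic.I; rewrite /preimage/=.
by case: (o i) => [->|/eqP/negbTE //]; rewrite eqxx.
Qed.

Lemma path_event_signs o t : pm_path t -> path_event m o t <-> signs t = o.
Proof.
move=> pt; split=> [ot|<- i _].
  apply/ffunP => i; rewrite ffunE ot// -[RHS]sgb_eq1.
  by apply/eqP/idP => [->|/set_mem//]; exact/mem_set.
rewrite ffunE; have [->|->] := pt i; first by rewrite eqxx.
by rewrite /sgb eq_sym -addr_eq0 -mulr2n pnatr_eq0.
Qed.

Lemma positionE n t : position X n t = \sum_(i < n) X i.+1 t.
Proof. by rewrite /position big_add1 big_mkord. Qed.

Lemma position_path o t : path_event m o t ->
  position X m t = m%:R - 2 * (minuses o)%:R.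
Proof.
move=> ot; rewrite positionE /minuses natr_sum mulr_sumr -[m in m%:R]card_ord.
rewrite -sumr_const -sumrB; apply: eq_bigr => i _; rewrite ot//.
by case: (o i) => /=; rewrite /sgb; ring.
Qed.

Lemma position_add N t : pm_path t -> position X (m + N) t =
  position X m t + (2 * (plus_count N t)%:R - N%:R).
Proof.
move=> pt; rewrite !positionE; elim: N => [|N IH].
  by rewrite addn0 /plus_count big_ord0; ring.
rewrite addnS big_ord_recr/= IH /plus_count big_ord_recr/= natrD -(natr1 N).
have [->|->] := pt (m + N)%N; first by rewrite eqxx/=; ring.
by rewrite eq_sym -addr_eq0 -mulr2n pnatr_eq0/=; ring.
Qed.

Lemma plus_count_le N t : (plus_count N t <= N)%N.
Proof.
rewrite -[leqRHS]card_ord -sum1_card; apply: leq_sum => i _.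
exact: leq_b1.
Qed.

Lemma Pr_signs o : Pr P (signs @^-1` [set o]) = Pr P (path_event m o).
Proof.
have m1 : (m.-1 < m)%N by rewrite prednK.
have [mo _] := indep_future_path o m1; rewrite prednK// in mo.
apply: Pr_ae => //; first exact: measurable_signs.
by apply: filterS ae_pm_path => t /path_event_signs ->.
Qed.

Lemma minuses_le o : (minuses o <= m)%N.
Proof.
rewrite -[leqRHS]card_ord -sum1_card; apply: leq_sum => i _.
exact: leq_b1.
Qed.

(** The position at time [m] depends on the path only through its number of minuses, and determines
    that number. *)
Lemma pmf_position k : pmf (position X m : {RV P >-> R}) (m%:R - 2 * k%:R) =
  \sum_(o : {ffun 'I_m -> bool} | minuses o == k) Pr P (path_event m o).
Proof.
have mS : measurable (position X m @^-1` [set m%:R - 2 * k%:R : R]).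
  by rewrite -[X in measurable X]setTI; apply: measurable_position => //;
    exact: measurable_set1.
rewrite /pmf -/(Pr P _) (total_probability_fin _ mS measurable_signs).
rewrite [RHS]big_mkcond; apply: eq_bigr => o _.
case: eqP => [ok|ok].
  rewrite -Pr_signs; apply: Pr_ae; [|exact: measurable_signs|].
    by apply: measurableI => //; exact: measurable_signs.
  apply: filterS ae_pm_path => t pt; split=> [[]//|so]; split => //=.
  by rewrite -ok (@position_path o)//; apply/path_event_signs.
rewrite -(Pr_set0 P); apply: Pr_ae => //.
  by apply: measurableI => //; exact: measurable_signs.
apply: filterS ae_pm_path => t pt; split=> // -[/= + so].
rewrite (@position_path o); last exact/path_event_signs.
move=> /addrI /oppr_inj /mulfI; rewrite pnatr_eq0 => /(_ isT) /eqP.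
by rewrite eqr_nat => /eqP.
Qed.

(* [Q k] tests the event [E] through the number [j] of pluses among the [N]
   steps following the [m] first ones, of which [k] are minuses. *)
Lemma Pr_position_event N (E : set T) (Q : nat -> pred nat) : measurable E ->
  (forall t k j, pm_path t -> position X m t = m%:R - 2 * k%:R ->
    position X (m + N) t = m%:R - 2 * k%:R + (2 * j%:R - N%:R) ->
    E t <-> Q k j) ->
  Pr P E = \sum_(0 <= k < m.+1)
    pmf (position X m : {RV P >-> R}) (m%:R - 2 * k%:R) *
    \sum_(0 <= j < N.+1) (Q k j)%:R * binomial_pmf N (plus_prob k) j.
Proof.
move=> mE EQ; rewrite (total_probability_fin _ mE measurable_signs).
under [RHS]eq_bigr do rewrite pmf_position mulr_suml.
rewrite big_mkord.
(* Paths are grouped by their number of minuses; [inord] is faithful because [minuses o <= m]. *)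
rewrite (partition_big (fun o => inord (minuses o) : 'I_m.+1) xpredT)//=.
apply: eq_bigr => k _; apply: eq_big => [ o | o /eqP ok].
  by rewrite -val_eqE/= inordK// ltnS minuses_le.
have {}ok : minuses o = k by rewrite -ok inordK// ltnS minuses_le.
have [mo _] := Pr_path_plus_count N 0 o.
have mEs : measurable (E `&` signs @^-1` [set o]).
  by apply: measurableI => //; exact: measurable_signs.
have cntE j : (fun t => inord (plus_count N t) : 'I_N.+1) @^-1` [set j] =
    [set t | plus_count N t = j].
  apply/seteqP; split=> t /=; first by move=> <-; rewrite inordK// ltnS plus_count_le.
  by move=> cj; apply: val_inj; rewrite /= inordK ?cj.
rewrite (@total_probability_fin _ _ _ P _
  (fun t => inord (plus_count N t) : 'I_N.+1) _ mEs); last first.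
  by move=> j; rewrite cntE; exact: measurable_plus_count.
rewrite big_mkord mulr_sumr; apply: eq_bigr => j _.
rewrite cntE -ok mulrCA -(proj2 (Pr_path_plus_count N j o)).
have [[mc _] _] := Pr_path_plus_count N j o.
have mEc : measurable (E `&` signs @^-1` [set o] `&` [set t | plus_count N t = j]).
  by apply: measurableI => //; exact: measurable_plus_count.
have Eiff t : pm_path t -> signs t = o -> plus_count N t = j ->
    E t <-> Q (minuses o) j.
  move=> pt /(path_event_signs _ pt) ot cj.
  apply: EQ => //; first exact: position_path.
  by rewrite position_add// cj (position_path ot).
case: (boolP (Q (minuses o) j)) => [Qj|/negP Qj]; rewrite ?mul1r ?mul0r.
  apply: Pr_ae => //; apply: filterS ae_pm_path => t pt; split.
    by move=> [[_ so] cj]; split=> //; apply/path_event_signs.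
  move=> [/(path_event_signs _ pt) so cj]; split=> //; split=> //.
  by apply/(Eiff t).
rewrite -(Pr_set0 P); apply: Pr_ae => //; apply: filterS ae_pm_path => t pt.
by split=> // -[[Et so] cj]; apply/Qj/(Eiff t).
Qed.

(** * Passage to the limit in the mixture *)

Lemma plus_prob_itv k : (k <= m)%N -> 0 < plus_prob k < 1.
Proof.
move=> km; have m0 : 0 < m%:R :> R by rewrite ltr0n.
have km' : k%:R <= m%:R :> R by rewrite ler_nat.
have k0 : 0 <= k%:R :> R by rewrite ler0n.
have pos (a b : R) : 0 < a -> 0 < b -> 0 < (m%:R - k%:R) * a + k%:R * b.
  move=> a0 b0; have [->|k1] := posnP k; first by rewrite mul0r subr0 addr0 mulr_gt0.
  by rewrite ltr_wpDl ?mulr_ge0 ?subr_ge0 ?mulr_gt0 ?ltr0n// ltW.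
have q0 : 0 < 1 - p by rewrite subr_gt0.
rewrite /plus_prob divr_gt0 ?pos//= ltr_pdivrMr// mul1r -subr_gt0.
(* Exchanging [p] and [1 - p] turns [plus_prob k] into its complement. *)
by have := pos _ _ q0 p_gt0; congr (0 < _); ring.
Qed.

(** After a shift of time by [m], [Pr_position_event] writes the [cdf] as a finite mixture, and
    limits are taken term by term. The alternative of zero weight serves the law of large numbers
    when [x] is one of the points [p_k]. *)
Lemma cdf_cvg (U : nat -> {RV P >-> R}) (x : R) (Q : nat -> nat -> pred nat)
    (L : nat -> R) :
  (forall N t k j, pm_path t -> position X m t = m%:R - 2 * k%:R ->
    position X (N + m) t = m%:R - 2 * k%:R + (2 * j%:R - N%:R) ->
    (U (N + m) t <= x) = Q k N j) ->
  (forall k, (k <= m)%N ->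
    pmf (position X m : {RV P >-> R}) (m%:R - 2 * k%:R) = 0 \/
    \sum_(0 <= j < N.+1) (Q k N j)%:R * binomial_pmf N (plus_prob k) j
      @[N --> \oo] --> L k) ->
  cdf (U n) x @[n --> \oo] -->
  (\sum_(0 <= k < m.+1)
    (pmf (position X m : {RV P >-> R}) (m%:R - 2 * k%:R))%:E * (L k)%:E)%E.
Proof.
move=> UQ QL; rewrite -(cvg_shiftn m).
under eq_bigr do rewrite -EFinM.
rewrite sumEFin.
have mU N : measurable (U N @^-1` `]-oo, x]) by exact: measurable_funPTI.
pose G N := \sum_(0 <= k < m.+1)
  pmf (position X m : {RV P >-> R}) (m%:R - 2 * k%:R) *
  \sum_(0 <= j < N.+1) (Q k N j)%:R * binomial_pmf N (plus_prob k) j.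
have GL : G N @[N --> \oo] --> \sum_(0 <= k < m.+1)
    pmf (position X m : {RV P >-> R}) (m%:R - 2 * k%:R) * L k.
  rewrite /G big_nat; under eq_fun do rewrite big_nat.
  apply: cvg_big => [|k]; first exact: add_continuous.
  rewrite ltnS => /= km.
  have [->|h] := QL _ km; last by apply: cvgMl_tmp.
  by under eq_fun do rewrite mul0r; rewrite mul0r; exact: cvg_cst.
have {}GL : (G N)%:E @[N --> \oo] --> (\sum_(0 <= k < m.+1)
    pmf (position X m : {RV P >-> R}) (m%:R - 2 * k%:R) * L k)%:E.
  by apply: cvg_EFin GL; exact: nearW.
apply: cvg_trans GL; apply: near_eq_cvg; apply: nearW => N.
rewrite /cdf /distribution /pushforward/= (PrE P (mU _)); congr EFin.
rewrite /G; apply/esym/(@Pr_position_event _ _ (fun k => Q k N)) => // t k j pt Sm SN.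
by rewrite /= in_itv/= (UQ _ _ _ j pt Sm)// addnC.
Qed.

Lemma near_le_cvg (u : nat -> R) (l x : R) : u N @[N --> \oo] --> l -> l != x ->
  \forall N \near \oo, (u N <= x) = (l <= x).
Proof.
move=> ul; rewrite neq_lt => /orP[lx|xl].
  by apply: filterS (cvgr_le _ ul _ lx) => N ->; rewrite (ltW lx).
rewrite leNgt xl/=.
by apply: filterS (cvgr_gt _ ul _ xl) => N h; rewrite leNgt h.
Qed.

Lemma sqrt_ratio_cvg :
  (Num.sqrt (N + m)%:R / Num.sqrt N.+1%:R)^-1 @[N --> \oo] --> (1 : R).
Proof.
rewrite -[1 in X in _ --> X]invr1; apply: cvgV; first exact: oner_neq0.
rewrite -[1 in X in _ --> X]sqrtr1.
have h : 1 + m.-1%:R / N.+1%:R @[N --> \oo] --> (1 : R).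
  rewrite -[X in _ --> X]addr0 -[X in 1 + X](mulr0 m.-1%:R).
  by apply: cvgD; [exact: cvg_cst|apply: cvgMl_tmp; exact: cvg_harmonic].
have {}h : Num.sqrt (1 + m.-1%:R / N.+1%:R) @[N --> \oo] --> Num.sqrt (1 : R).
  exact: (@continuous_cvg _ _ _ _ _ _ Num.sqrt _ (@sqrt_continuous R 1) h).
apply: cvg_trans h; apply: near_eq_cvg; apply: nearW => N /=.
rewrite -sqrtrV// -sqrtrM ?ler0n//; congr Num.sqrt.
have -> : (N + m = N.+1 + m.-1)%N by lia.
by rewrite natrD mulrDl divff ?pnatr_eq0.
Qed.

(** The part of the centred position that does not grow with [N]; division by a square root removes
    it in the limit. *)
Definition drift (k : nat) : R :=
  2 * plus_prob k * (1 - m%:R) + 2 * m%:R - 2 * k%:R.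

(** [S * (2 * p - 1) / m%:R] is [2 * plus_prob k - 1], the conditional mean of a later step, so the
    terms linear in [N] agree. *)
Lemma center_position N k j (S := m%:R - 2 * k%:R : R) :
  S + (2 * j%:R - N%:R) - S * ((N + m)%:R * (2 * p - 1) / m%:R) =
  2 * (j%:R - N.+1%:R * plus_prob k) + drift k.
Proof.
have m0 : m%:R != 0 :> R by rewrite pnatr_eq0 -lt0n.
by rewrite /S /drift /plus_prob natrD -(natr1 N); field.
Qed.

Lemma scaled_position_cvg k (j : nat -> nat) (y : R) (S := m%:R - 2 * k%:R : R) :
  2 * ((j N)%:R - N.+1%:R * plus_prob k) / Num.sqrt N.+1%:R @[N --> \oo] --> y ->
  (S + (2 * (j N)%:R - N%:R) - S * ((N + m)%:R * (2 * p - 1) / m%:R)) *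
    (Num.sqrt (N + m)%:R)^-1 @[N --> \oo] --> y.
Proof.
move=> jy.
have h : (2 * ((j N)%:R - N.+1%:R * plus_prob k) / Num.sqrt N.+1%:R +
    drift k * (Num.sqrt N.+1%:R)^-1) *
    (Num.sqrt (N + m)%:R / Num.sqrt N.+1%:R)^-1 @[N --> \oo] --> y.
  rewrite -[X in _ --> X]mulr1; apply: cvgM; last exact: sqrt_ratio_cvg.
  rewrite -[X in _ --> X]addr0 -[X in _ + X](mulr0 (drift k)).
  by apply: cvgD => //; apply: cvgMl_tmp; exact: cvg_invr_sqrtS.
apply: cvg_trans h; apply: near_eq_cvg; apply: nearW => N /=.
rewrite center_position.
have s0 : Num.sqrt N.+1%:R != 0 :> R by rewrite gt_eqF// sqrtr_gt0.
have b0 : Num.sqrt (N + m)%:R != 0 :> R.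
  by rewrite gt_eqF// sqrtr_gt0 ltr0n addn_gt0 m_ge1 orbT.
by field; rewrite s0 b0.
Qed.

(** The difference from the limit is the scaled position, which converges, divided by one more
    square root. *)
Lemma mean_position_cvg k (j : nat -> nat) (y : R) (S := m%:R - 2 * k%:R : R) :
  2 * ((j N)%:R - N.+1%:R * plus_prob k) / Num.sqrt N.+1%:R @[N --> \oo] --> y ->
  (S + (2 * (j N)%:R - N%:R)) * (N + m)%:R^-1 @[N --> \oo] -->
    S * (2 * p - 1) / m%:R.
Proof.
move=> jy.
have h : S * (2 * p - 1) / m%:R +
    (S + (2 * (j N)%:R - N%:R) - S * ((N + m)%:R * (2 * p - 1) / m%:R)) *
    (Num.sqrt (N + m)%:R)^-1 * ((Num.sqrt (N + m)%:R / Num.sqrt N.+1%:R)^-1 *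
    (Num.sqrt N.+1%:R)^-1) @[N --> \oo] --> S * (2 * p - 1) / m%:R.
  rewrite -[X in _ --> X]addr0; apply: cvgD; first exact: cvg_cst.
  rewrite -[X in _ --> X](mulr0 y); apply: cvgM; first exact: scaled_position_cvg.
  rewrite -[X in _ --> X](mulr0 1); apply: cvgM; first exact: sqrt_ratio_cvg.
  exact: cvg_invr_sqrtS.
apply: cvg_trans h; apply: near_eq_cvg; apply: nearW => N /=.
have m0 : m%:R != 0 :> R by rewrite pnatr_eq0 -lt0n.
have s0 : Num.sqrt N.+1%:R != 0 :> R by rewrite gt_eqF// sqrtr_gt0.
have b0 : Num.sqrt (N + m)%:R != 0 :> R.
  by rewrite gt_eqF// sqrtr_gt0 ltr0n addn_gt0 m_ge1 orbT.
have bb : (N + m)%:R = Num.sqrt (N + m)%:R ^+ 2 :> R by rewrite sqr_sqrtr.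
move: (S) (Num.sqrt N.+1%:R) (Num.sqrt (N + m)%:R) s0 b0 bb => S' s b s0 b0 ->.
by field; rewrite s0 b0 m0.
Qed.

(** The limit [l] is the same at every rescaled position [y], so the test settles to one truth value
    and [A] is the whole line or empty. *)
Lemma binomial_le_cvg k (v : nat -> nat -> R) (l x : R) : (k <= m)%N -> l != x ->
  (forall (j : nat -> nat) (y : R),
    2 * ((j N)%:R - N.+1%:R * plus_prob k) / Num.sqrt N.+1%:R @[N --> \oo] --> y ->
    v N (j N) @[N --> \oo] --> l) ->
  \sum_(0 <= j < N.+1) (v N j <= x)%R%:R * binomial_pmf N (plus_prob k) j
    @[N --> \oo] --> ((l <= x)%R%:R : R).
Proof.
move=> km lx vl; pose A : set R := if l <= x then setT else set0.
have -> : (l <= x)%R%:R =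
    fine (normal_prob 0 (Num.sqrt (4 * (plus_prob k * (1 - plus_prob k)))) A).
  rewrite /A; case: (l <= x); first by rewrite probability_setT.
  by rewrite measure0.
apply: (@binomial_sum_cvg _ _ (fun N j => v N j <= x) A 0).
- exact: plus_prob_itv.
- by rewrite /A; case: (l <= x).
- move=> y j _ jy; apply: filterS (near_le_cvg (vl _ _ jy) lx) => N ->.
  by rewrite /A; case: (l <= x); rewrite ?in_setT ?in_set0.
Qed.

(** * The two limit laws *)

Lemma erw_law_of_large_numbers :
  cvg_in_distribution P
    (fun n => n%:R^-1 \o* (position X n : {RV P >-> R}))
    (fun x => \sum_(0 <= k < m.+1)
      (pmf (position X m : {RV P >-> R}) (m%:R - 2 * k%:R))%:E *
      dirac_cdf ((m%:R - 2 * k%:R) * (2 * p - 1) / m%:R) x)%E.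
Proof.
pose q k := pmf (position X m : {RV P >-> R}) (m%:R - 2 * k%:R).
pose l k : R := (m%:R - 2 * k%:R) * (2 * p - 1) / m%:R.
pose f x : R := \sum_(0 <= k < m.+1) q k * (l k <= x)%R%:R.
have dE a x : dirac_cdf a x = ((a <= x)%R%:R : R)%:E.
  rewrite /dirac_cdf diracE; congr (_%:R%:E); congr nat_of_bool.
  apply/idP/idP => [/set_mem|ax]; first by rewrite /= in_itv.
  by apply/mem_set; rewrite /= in_itv.
move=> x; rewrite (_ : (fun _ => _) = EFin \o f); last first.
  apply/funext => y; rewrite /f /= -sumEFin; apply: eq_bigr => k _.
  by rewrite dE EFinM.
move=> cF.
have q0 k : 0 <= q k by exact: pmf_ge0.
(* An atom at a continuity point has weight 0: at [x - n.+1%:R^-1] the function [f] is at most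
   [f x - q k], because term [k] is missing there and no other term exceeds its value at [x]. *)
have qx k : (k <= m)%N -> l k = x -> q k = 0.
  move=> km kx; apply/eqP; rewrite eq_le q0 andbT leNgt; apply/negP => qk.
  have hx : x - n.+1%:R^-1 @[n --> \oo] --> x.
    rewrite -[X in _ --> X]subr0; apply: cvgB; first exact: cvg_cst.
    exact: cvg_harmonic.
  have fx : f (x - n.+1%:R^-1) @[n --> \oo] --> f x.
    apply: (fine_cvg (f := fun n => (f (x - n.+1%:R^-1))%:E)).
    exact: (@continuous_cvg _ _ _ _ _ _ (EFin \o f) x cF hx).
  have lt : f x - q k < f x by rewrite ltrBlDr ltrDl.
  have [n] := filter_ex (cvgr_gt _ fx _ lt).
  apply/negP; rewrite -leNgt lerBrDr /f.
  rewrite !big_mkord (bigD1 (inord k : 'I_m.+1))//=.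
  rewrite [leRHS](bigD1 (inord k : 'I_m.+1))//= inordK ?ltnS// kx lexx mulr1.
  rewrite (lt_geF (_ : x - _ < x)) /= ?mulr0 ?add0r; last first.
    by rewrite ltrBlDr ltrDl invr_gt0.
  rewrite [leLHS]addrC lerD2l; apply: ler_sum => i _; rewrite ler_wpM2l// ler_nat.
  have [h|//] := leP (l i) (x - _).
  by rewrite (le_trans h)// lerBlDr lerDl invr_ge0.
under eq_bigr do rewrite dE.
apply: (@cdf_cvg _ _ (fun k N j =>
  (m%:R - 2 * k%:R + (2 * j%:R - N%:R)) * (N + m)%:R^-1 <= x)).
  by move=> N t k j _ _ SN /=; rewrite SN.
move=> k km; have [lx|lx] := eqVneq (l k) x; first by left; exact: qx.
right; apply: (binomial_le_cvg (v := fun N j => _)) => // j y.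
exact: mean_position_cvg.
Qed.

Lemma erw_central_limit :
  cvg_in_distribution P
    (fun n => (Num.sqrt n%:R)^-1 \o*
      ((position X n : {RV P >-> R}) \- (n%:R * (2 * p - 1) / m%:R) \o*
        (position X m : {RV P >-> R})))
    (fun x => \sum_(0 <= k < m.+1)
      (pmf (position X m : {RV P >-> R}) (m%:R - 2 * k%:R))%:E *
      normal_cdf (4 * plus_prob k * (1 - plus_prob k))%R x)%E.
Proof.
move=> x _.
under eq_bigr => k _.
  rewrite /normal_cdf -mulrA -[X in (_ * X)%E]fineK ?fin_num_measure//.
  over.
apply: (@cdf_cvg _ _ (fun k N j =>
  (m%:R - 2 * k%:R + (2 * j%:R - N%:R) -
    (m%:R - 2 * k%:R) * ((N + m)%:R * (2 * p - 1) / m%:R)) *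
    (Num.sqrt (N + m)%:R)^-1 <= x)).
  by move=> N t k j _ Sm SN /=; rewrite SN Sm.
move=> k km; right.
(* The exceptional point is the end [x] of the half-line, where the test need not stabilize. *)
apply: (binomial_sum_cvg (y := x)) => //; first exact: plus_prob_itv.
move=> y j yx /scaled_position_cvg h.
apply: filterS (near_le_cvg h yx) => N ->.
by apply/idP/idP => [yx'|/set_mem]; [apply/mem_set|]; rewrite /= in_itv.
Qed.

End elephant.

Theorem theorem7p1 (d : measure_display) (T : measurableType d) (R : realType)
    (P : probability T R) (p : R) (m : nat)
    (X : nat -> {RV P >-> R}) (K : nat -> {RV P >-> nat})
    (B : nat -> {RV P >-> bool})
    (p_gt0 : 0 < p) (p_lt1 : p < 1) (m_ge1 : (1 <= m)%N)
    (erw : elephant_first_steps p m X K B)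
    (X1_plus : P (X 1%N @^-1` [set 1]) = p%:E)
    (X1_minus : P (X 1%N @^-1` [set -1]) = (1 - p)%:E) :
  let S (n : nat) : {RV P >-> R} := position X n in
  let q (k : nat) : R := pmf (S m) (m%:R - 2 * k%:R) in
  let r (k : nat) : R := ((m%:R - k%:R) * p + k%:R * (1 - p)) / m%:R in
  let pk (k : nat) : R := (m%:R - 2 * k%:R) * (2 * p - 1) / m%:R in
  cvg_in_distribution P
    (fun n => n%:R^-1 \o* S n)
    (fun x => \sum_(0 <= k < m.+1) (q k)%:E * dirac_cdf (pk k) x)%E
  /\
  cvg_in_distribution P
    (fun n => (Num.sqrt n%:R)^-1 \o*
       (S n \- (n%:R * (2 * p - 1) / m%:R) \o* S m))
    (fun x => \sum_(0 <= k < m.+1)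
       (q k)%:E * normal_cdf (4 * r k * (1 - r k))%R x)%E.
Proof.
split; first exact: (erw_law_of_large_numbers p_gt0 p_lt1 m_ge1 erw).
exact: (erw_central_limit p_gt0 p_lt1 m_ge1 erw).
Qed.
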